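(* Assume the empirical CLT holds over $\mathcal{C}$ with limit $\{G(t,x):(t,x)\in E\times\mathbb{R}\}$, and that for every $t\in E$ the distribution function $F(t,\cdot)$ is strictly increasing and has a density $f(t,\cdot)$, where these densities satisfy $$\lim_{\delta\to 0}\ \sup_{t\in E}\ \sup_{|u-v|\le\delta}|f(t,u)-f(t,v)|=0,$$ and for every closed interval $I$ in $(0,1)$ there is $\theta(I)>0$ such that $$\inf_{t\in E,\ \alpha\in I,\ |x-\tau_\alpha(t)|\le\theta(I)} f(t,x)>0 .$$ Then, for $I$ a closed subinterval of $(0,1)$, the quantile processes $\{\sqrt n(\tau^n_\alpha(t)-\tau_\alpha(t))f(t,\tau_\alpha(t)):n\ge1\}$ satisfy the CLT in $\ell_\infty(E\times I)$ with Gaussian limit process $\{G(t,\tau_\alpha(t)):(t,\alpha)\in E\times I\}$. Moreover, the quantile processes $\{\sqrt n(\tau^n_\alpha(t)-\tau_\alpha(t)):n\ge1\}$ also satisfy the CLT in $\ell_\infty(E\times I)$ with Gaussian limit process $\{G(t,\tau_\alpha(t))/f(t,\tau_\alpha(t)):(t,\alpha)\in E\times I\}$.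
   Context: $E$ is a set, $D(E)$ is a collection of real-valued functions on $E$, and $X=\{X(t):t\in E\}$ is a stochastic process with $P(X(\cdot)\in D(E))=1$. $X_1,X_2,\dots$ are i.i.d. copies of $X$ on a probability space that also carries the process $G$ below. Put $F(t,x)=P(X(t)\le x)$, $F_n(t,x)=\frac1n\sum_{i=1}^n I(X_i(t)\le x)$, $\nu_n(t,x)=\sqrt n(F_n(t,x)-F(t,x))$, $C_{t,x}=\{z\in D(E):z(t)\le x\}$, $\mathcal C=\{C_{t,x}:t\in E,x\in\mathbb R\}$ (identified with $E\times\mathbb R$). $\ell_\infty(S)$ is the space of bounded real functions on $S$ with the sup-norm. ''The (empirical) CLT holds over $\mathcal C$ with limit $G$'' means: there is a centered Gaussian process $G=\{G(t,x)\}$ on $E\times\mathbb R$ with covariance $E(G(s,x)G(t,y))=P(X(s)\le x,X(t)\le y)-F(s,x)F(t,y)$ whose law on $\ell_\infty(E\times\mathbb R)$ is Radon, equivalently whose sample paths are bounded and uniformly continuous with respect to its $L_2$-distance $d((s,x),(t,y))=(E[(G(s,x)-G(t,y))^2])^{1/2}$, and $\lim_n E^*h(\nu_n)=E\,h(G)$ for every bounded continuous $h:\ell_\infty(E\times\mathbb R)\to\mathbb R$, where $E^*$ is upper expectation. In general, processes $V_n$ indexed by a set $S$ satisfy the CLT in $\ell_\infty(S)$ with Gaussian limit $V$ if $V$ is a centered Gaussian process with Radon law on $\ell_\infty(S)$ and $E^*h(V_n)\to E\,h(V)$ for every bounded continuous $h:\ell_\infty(S)\to\mathbb R$. Quantiles: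 $\tau_\alpha(t)=\inf\{x:F(t,x)\ge\alpha\}$ and $\tau^n_\alpha(t)=\inf\{x:F_n(t,x)\ge\alpha\}$ for $\alpha\in(0,1)$. A closed subinterval of $(0,1)$ means a compact interval $[a,b]\subset(0,1)$. *)

(* Defs.v *)
From HB Require Import structures.
From mathcomp Require Import all_boot all_order all_algebra.
From mathcomp Require Import all_classical all_reals all_analysis.

Set Implicit Arguments.
Unset Strict Implicit.
Unset Printing Implicit Defensive.

Import Order.TTheory GRing.Theory Num.Theory.
Import numFieldNormedType.Exports.

Local Open Scope classical_set_scope.
Local Open Scope ring_scope.

(* A process indexed by S is a function V : S -> T -> R; V ^~ w is its sample
   path at w. *)

(* The functions z : S -> R carry the topology of uniform convergence, in which
   linf S is open and closed; the topology it induces on linf S is that of the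
   sup-norm. *)
Definition linf (R : realType) (S : choiceType) : set {uniform S -> R} :=
  bounded_fun.

Definition uborel (R : realType) (S : choiceType)
    : set (set {uniform S -> R}) :=
  <<s [set U | open U] >>.

Definition upper_expectation d (T : measurableType d) (R : realType)
    (P : probability T R) (Y : T -> R) : \bar R :=
  ereal_inf [set (\int[P]_w U w)%E | U in
    [set U : T -> \bar R | P.-integrable setT U /\
                           forall w, ((Y w)%:E <= U w)%E]].

(* normal_prob 0 s has standard deviation s, but is a normal distribution only
   for s != 0; hence the separate degenerate case. *)
Definition centered_gaussian_rv d (T : measurableType d) (R : realType)
    (P : probability T R) (Y : T -> R) : Prop :=
  measurable_fun setT Y /\
  ((forall B : set R, measurable B -> P (Y @^-1` B) = \d_(0 : R) B) \/
   exists2 s : R, 0 < s &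
     forall B : set R, measurable B -> P (Y @^-1` B) = normal_prob 0 s B).

Definition centered_gaussian_process d (T : measurableType d) (R : realType)
    (P : probability T R) (S : Type) (V : S -> T -> R) : Prop :=
  forall (m : nat) (s : 'I_m -> S) (c : 'I_m -> R),
    centered_gaussian_rv P (fun w => \sum_(j < m) c j * V (s j) w).

(* V is a Borel random element of linf S whose law is inner regular with respect
   to the compact sets. The Borel sets of linf S are the traces of those of
   uborel R S, and compact sets are closed because R is Hausdorff. *)
Definition radon_law_linf d (T : measurableType d) (R : realType)
    (P : probability T R) (S : choiceType) (V : S -> T -> R) : Prop :=
  let path w : {uniform S -> R} := V ^~ w in
  [/\ forall w, linf (path w),
      forall B, uborel B -> measurable (path @^-1` B) &
      forall B, uborel B -> forall e : R, 0 < e ->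
        exists K : set {uniform S -> R},
          [/\ compact K, K `<=` B & (P (path @^-1` (B `\` K)) < e%:E)%E]].

(* V_ n may have unbounded sample paths, so the test functions h are defined on
   all of S -> R. Only their continuity on linf S is required, and outside linf S
   they are arbitrary but still bounded: taking h = 1 outside linf S and h = 0 on
   it, one sees that the outer probability that V_ n is not in linf S has to
   tend to 0. *)
Definition clt_linf d (T : measurableType d) (R : realType)
    (P : probability T R) (S : choiceType)
    (V_ : nat -> S -> T -> R) (V : S -> T -> R) : Prop :=
  [/\ centered_gaussian_process P V,
      radon_law_linf P V &
      forall h : {uniform S -> R} -> R,
        [bounded h z | z in setT] ->
        {within @linf R S, continuous h} ->
        upper_expectation P (fun w => h (V_ n ^~ w)) @[n --> \oo]
          --> 'E_P[fun w => h (V ^~ w)]%E].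

Definition cylinder_sets (R : realType) (E : Type) : set (set (E -> R)) :=
  <<s [set A | exists t, exists2 B : set R,
                 measurable B & A = [set z | B (z t)]] >>.

Definition iid_copies d0 d (T0 : measurableType d0) (T : measurableType d)
    (R : realType) (P0 : probability T0 R) (P : probability T R) (E : Type)
    (X : E -> {RV P0 >-> R}) (Xs : nat -> E -> {RV P >-> R}) : Prop :=
  (forall i (A : set (E -> R)), cylinder_sets A ->
     P [set w | A (fun t => Xs i t w)] = P0 [set w | A (fun t => X t w)]) /\
  (forall n (A : nat -> set (E -> R)), (forall i, cylinder_sets (A i)) ->
     P [set w | forall i, (i < n)%N -> A i (fun t => Xs i t w)] =
     (\prod_(i < n) P [set w | A i (fun t => Xs i t w)])%E).

Definition dist_fun d0 (T0 : measurableType d0) (R : realType)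
    (P0 : probability T0 R) (E : Type) (X : E -> {RV P0 >-> R})
    (t : E) (x : R) : R :=
  fine (cdf (X t) x).

(* The sample X_1, ..., X_n is Xs 0, ..., Xs (n - 1). *)
Definition emp_dist_fun d (T : measurableType d) (R : realType)
    (P : probability T R) (E : Type) (Xs : nat -> E -> {RV P >-> R})
    (n : nat) (t : E) (x : R) (w : T) : R :=
  n%:R^-1 * \sum_(i < n) \1_(`]-oo, x]) (Xs i t w).

Definition emp_process d0 d (T0 : measurableType d0) (T : measurableType d)
    (R : realType) (P0 : probability T0 R) (P : probability T R) (E : Type)
    (X : E -> {RV P0 >-> R}) (Xs : nat -> E -> {RV P >-> R})
    (n : nat) (s : E * R) (w : T) : R :=
  Num.sqrt n%:R * (emp_dist_fun Xs n s.1 s.2 w - dist_fun X s.1 s.2).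

(* The class of the sets C_{t,x} is indexed by E * R. *)
Definition empirical_clt d0 d (T0 : measurableType d0) (T : measurableType d)
    (R : realType) (P0 : probability T0 R) (P : probability T R)
    (E : choiceType) (X : E -> {RV P0 >-> R}) (Xs : nat -> E -> {RV P >-> R})
    (G : E * R -> T -> R) : Prop :=
  (forall s x t y,
     'E_P[fun w => (G (s, x) w * G (t, y) w)%R]%E =
     (P0 [set w | (X s w <= x)%R /\ (X t w <= y)%R] -
      (dist_fun X s x * dist_fun X t y)%:E)%E) /\
  clt_linf P (emp_process X Xs) G.

Definition quantile (R : realType) (H : R -> R) (alpha : R) : R :=
  inf [set x | alpha <= H x].

Definition quantile_process d0 d (T0 : measurableType d0)
    (T : measurableType d) (R : realType) (P0 : probability T0 R)
    (P : probability T R) (E : Type)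
    (X : E -> {RV P0 >-> R}) (Xs : nat -> E -> {RV P >-> R})
    (n : nat) (t : E) (alpha : R) (w : T) : R :=
  Num.sqrt n%:R * (quantile (fun x => emp_dist_fun Xs n t x w) alpha -
                   quantile (dist_fun X t) alpha).

Definition has_density (R : realType) (H f : R -> R) : Prop :=
  [/\ measurable_fun setT f, forall u, 0 <= f u &
      forall x, (H x)%:E =
        (\int[@lebesgue_measure R]_(u in `]-oo, x]) (f u)%:E)%E].

Definition sup_modulus (R : realType) (E : Type) (f : E -> R -> R)
    (delta : R) : \bar R :=
  ereal_sup [set r | exists t u v,
    `|u - v| <= delta /\ r = (`|f t u - f t v|)%:E].

(* Main.v *)
Require Import Defs.
From HB Require Import structures.
From mathcomp Require Import all_boot all_order all_algebra.
From mathcomp Require Import all_classical all_reals all_analysis.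
From mathcomp Require Import measurable_realfun.
From mathcomp Require Import ring lra.

(** The theorem is a functional delta method for the inverse map F |-> tau.
    Write nu_n = sqrt n (F_n - F), tau for the quantile of F(t, .) and tau^n for
    that of F_n(t, .). Since F_n is F + nu_n / sqrt n, solving F_n = alpha near
    tau gives
      sqrt n (tau^n - tau) f(t, tau) = - nu_n(t, tau) + remainder,
    so the normalized quantile process should have the limit - G(t, tau), which
    has the law of G(t, tau) because G is centered Gaussian.

    The remainder is controlled by a deterministic estimate
    (quantile_linearization): it is small, uniformly in t and alpha, as soon as
    nu_n is bounded by a constant M, and its oscillation between points x, y with
    |F(t, x) - F(t, y)| <= rho is small. That nu_n has these two properties with
    high outer probability follows from the weak convergence nu_n ==> G
    (clt_outer_near) once G has them. For G they come from tightness alone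
    (radon_law_uniformly_continuous): a ball of small radius that has positive
    probability contains, by Chebyshev's inequality, a path with a small increment
    between any two points at small L2-distance; hence all paths in the ball have
    a small increment there, and finitely many balls cover a compact set of
    probability close to 1. The L2-distance between G(t, x) and G(t, y) is at most
    |F(t, x) - F(t, y)|^(1/2), as the covariance shows.

    Two further facts about weak convergence are needed. Slutsky's lemma
    (clt_slutsky) allows one to drop the remainder; as the test functions are only
    continuous, it uses their uniform continuity near a compact set. The symmetry
    of the law of G on the function space (gaussian_law_opp) is a uniqueness
    statement: the hypothesis gives the laws of all linear combinations
    L(G) = sum_j c_j G(s_j), which determine the expectation of cos(L(G) + theta)
    and so of all trigonometric polynomials; by a Stone-Weierstrass argument these
    approximate every continuous function on a compact set.

    Composing with (t, alpha) |-> (t, tau) and multiplying by a bounded weight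
    preserve weak convergence (clt_reweight). This transports the limit from
    E * R to E * [a, b], and gives the second statement from the first with the
    weight 1 / f(t, tau), which is bounded since f is bounded below there. *)

Set Implicit Arguments.
Unset Strict Implicit.
Unset Printing Implicit Defensive.

Import Order.TTheory GRing.Theory Num.Theory.
Import numFieldNormedType.Exports.

Local Open Scope classical_set_scope.
Local Open Scope ring_scope.

(** * Uniform closeness and compact sets of functions *)

(** Compactness in the form of an induction principle: a property of sets that is
    stable under subsets and finite unions, and holds near each point of K, holds
    for K. Otherwise the sets A such that K minus A has the property would form a
    proper filter on K without cluster point. It replaces the extraction of
    finite subcovers and the choice of finitely many constants. *)
Lemma compact_ideal (X : topologicalType) (K : set X) (I : set (set X)) :
  compact K -> I set0 ->
  (forall A B, B `<=` A -> I A -> I B) ->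
  (forall A B, I A -> I B -> I (A `|` B)) ->
  (forall x, K x -> exists2 U, nbhs x U & I U) ->
  I K.
Proof.
move=> cK I0 Isub IU Iloc; apply: contrapT => nIK.
pose F : set (set X) := [set A | I (K `\` A)].
have FF : Filter F.
  split.
  - by rewrite /F /= setDT.
  - by move=> A B; rewrite /F /= setDIr => FA FB; exact: IU.
  - by move=> A B AB; apply: Isub => x [Kx nB]; split=> // /AB.
have PF : ProperFilter F.
  by apply: Build_ProperFilter => F0; apply: nIK; move: F0; rewrite /F /= setD0.
have [|x [Kx clx]] := cK F PF; first by rewrite /F /= setDv.
have [U Ux IU'] := Iloc x Kx.
(* x is a cluster point of F, so U meets its own complement *)
have FU : F (~` U) by rewrite /F /=; apply: Isub IU' => y [_ /contrapT].
by have [y [nU Uy]] := clx _ _ FU Ux.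
Qed.

Section sup_metric.
Variables (R : realType) (S : choiceType).
Implicit Types (y z : {uniform S -> R}) (e r : R).

(** The sup-distance itself is of no use here: sample paths may be unbounded, and
    so lie at infinite distance. *)
Definition sup_close e (y z : S -> R) := forall s, `|y s - z s| <= e.

Lemma sup_closeC e (y z : S -> R) : sup_close e y z -> sup_close e z y.
Proof. by move=> h s; rewrite distrC. Qed.

Lemma sup_close_trans e r (x y z : S -> R) :
  sup_close e x y -> sup_close r y z -> sup_close (e + r) x z.
Proof.
move=> h h' s; apply: le_trans (lerD (h s) (h' s)).
by rewrite -{1}(subrKA (y s) (x s)) ler_normD.
Qed.

Lemma sup_closeW e r (y z : S -> R) : e <= r -> sup_close e y z -> sup_close r y z.
Proof. by move=> er h s; apply: le_trans er. Qed.

Lemma sup_closexx e (z : S -> R) : 0 <= e -> sup_close e z z.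
Proof. by move=> e0 s; rewrite subrr normr0. Qed.

Lemma nbhs_sup_closeP z (A : set {uniform S -> R}) :
  nbhs z A <-> exists2 e, 0 < e & forall y : {uniform S -> R}, sup_close e z y -> A y.
Proof.
rewrite uniform_nbhs; split.
  move=> [E [+ EA]]; rewrite -entourage_ballE => -[e /= e0 eE].
  exists (e / 2) => [|y zy]; first by rewrite divr_gt0.
  apply: EA => s _; apply: eE => /=.
  rewrite /ball /=; apply: le_lt_trans (zy s) _.
  by rewrite ltr_pdivrMr// mulr_natr mulr2n ltrDr.
move=> [e e0 eA]; exists [set xy | ball xy.1 e xy.2]; split.
  by rewrite -entourage_ballE; exists e.
move=> y zy; apply: eA => s; exact/ltW/(zy s I).
Qed.

Lemma linfP (z : {uniform S -> R}) : linf z <-> exists M, forall s, `|z s| <= M.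
Proof.
split=> [[M [_ zM]]|[M zM]].
  by exists (M + 1) => s; apply: (zM (M + 1)) => //; rewrite ltrDl.
exists M; split; first exact: num_real.
by move=> x Mx s _; apply: le_trans (zM s) (ltW Mx).
Qed.

Lemma sup_close_linf e (y z : {uniform S -> R}) : sup_close e y z -> linf y -> linf z.
Proof.
move=> yz /linfP [M yM]; apply/linfP; exists (M + e) => s.
have := ler_normB (y s) (y s - z s).
rewrite subKr => /le_trans; apply.
exact: lerD (yM s) (yz s).
Qed.

Lemma open_linf : open (@linf R S).
Proof.
rewrite openE => z lz; apply/nbhs_sup_closeP; exists 1 => // y zy.
exact: sup_close_linf zy lz.
Qed.

Lemma continuous_linfP (h : {uniform S -> R} -> R) :
  {within @linf R S, continuous h} <->
  (forall z, linf z -> forall e, 0 < e -> exists2 r, 0 < r &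
     forall y, sup_close r z y -> `|h z - h y| <= e).
Proof.
rewrite continuous_open_subspace; last exact: open_linf.
split=> [ch z lz e e0|H z].
  have he : nbhs (h z) [set u | `|h z - u| <= e].
    by apply/nbhs_ballP; exists e => //= u; exact: ltW.
  by have /nbhs_sup_closeP[r r0 hr] := ch z (mem_set lz) _ he; exists r.
rewrite inE => lz A /nbhs_ballP[e /= e0 eA].
have [r r0 hr] := H z lz _ (divr_gt0 e0 (@ltr0Sn R 1)).
apply/nbhs_sup_closeP; exists r => // y /hr hy; apply: eA.
by rewrite /ball /=; apply: le_lt_trans hy _; rewrite ltr_pdivrMr//; lra.
Qed.

(** One inequality is enough, because closeness is symmetric. *)
Lemma lipschitz_continuous_linf (h : {uniform S -> R} -> R) (C : R) : 0 < C ->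
  (forall e y z, 0 < e -> sup_close e y z -> h y <= h z + C * e) ->
  {within @linf R S, continuous h}.
Proof.
move=> C0 hC; apply/continuous_linfP => z _ e e0.
exists (e / C); first by rewrite divr_gt0.
move=> y zy.
have h1 := hC _ _ _ (divr_gt0 e0 C0) zy.
have h2 := hC _ _ _ (divr_gt0 e0 C0) (sup_closeC zy).
move: h1 h2; rewrite mulrC divfK ?gt_eqF// => h1 h2.
by rewrite ler_norml; apply/andP; split; lra.
Qed.

(** The distance to A, truncated at 1; the element 1 also keeps the infimum
    meaningful when no member of A is at finite distance from z. *)
Definition dist_set (A : set {uniform S -> R}) z : R :=
  inf ([set 1] `|` [set r | 0 <= r /\ exists2 y, A y & sup_close r z y]).

Let dist_has_inf A z :
  has_inf ([set 1] `|` [set r | 0 <= r /\ exists2 y, A y & sup_close r z y]).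
Proof.
split; first by exists 1; left.
by exists 0 => r [->//|[]].
Qed.

Lemma dist_set_ge0 A z : 0 <= dist_set A z.
Proof.
apply: lb_le_inf; first by exists 1; left.
by move=> r [->//|[]].
Qed.

Lemma dist_set_le1 A z : dist_set A z <= 1.
Proof. by apply: ge_inf; [case: (dist_has_inf A z)|left]. Qed.

Lemma dist_set_le A r y z : 0 <= r -> A y -> sup_close r z y -> dist_set A z <= r.
Proof.
move=> r0 Ay zy.
by apply: ge_inf; [case: (dist_has_inf A z)|right; split=> //; exists y].
Qed.

Lemma dist_set_lt A r z : r <= 1 -> dist_set A z < r ->
  exists2 y, A y & sup_close r z y.
Proof.
move=> r1 /(inf_lt (dist_has_inf A z).1) [q [->|[q0 [y Ay zy]] qr]].
  by rewrite ltNge r1.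
by exists y => //; apply: sup_closeW zy; exact: ltW.
Qed.

Lemma dist_set_lipschitz A e y z : 0 < e -> sup_close e y z ->
  dist_set A y <= dist_set A z + e.
Proof.
move=> e0 yz; rewrite -lerBlDr; apply: lb_le_inf; first by exists 1; left.
move=> r [->|[r0 [x Ax zx]]]; rewrite lerBlDr.
  by apply: le_trans (dist_set_le1 A y) _; lra.
apply: (@dist_set_le _ _ x) => //; first lra.
by rewrite addrC; exact: sup_close_trans yz zx.
Qed.

Lemma compact_closed_sup (K : set {uniform S -> R}) : compact K -> open (~` K).
Proof.
move=> cK; rewrite openE => y nKy; apply/nbhs_sup_closeP.
pose I := [set A : set {uniform S -> R} |
  exists2 e, 0 < e & forall z, sup_close e y z -> ~ A z].
suff [e e0 he] : I K by exists e.
apply: (compact_ideal cK).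
- by exists 1 => // z _ [].
- by move=> A B BA [e e0 he]; exists e => // z /he + /BA.
- move=> A B [e e0 he] [r r0 hr]; exists (Num.min e r); first by rewrite lt_min e0.
  by move=> z yz [/he|/hr]; apply; apply: sup_closeW yz; rewrite ge_min lexx ?orbT.
- move=> x Kx.
  have [s xs] : exists s, y s != x s.
    apply: contrapT => /forallNP nyx; apply: nKy.
    suff -> : y = x by [].
    by apply/funext => s; apply: contrapT => /eqP; exact: nyx.
  have d0 : 0 < `|y s - x s| by rewrite normr_gt0 subr_eq0.
  exists [set z | sup_close (`|y s - x s| / 3) x z].
    by apply/nbhs_sup_closeP; exists (`|y s - x s| / 3); rewrite ?divr_gt0.
  exists (`|y s - x s| / 3) => [|z yz xz]; first by rewrite divr_gt0.
  have := sup_close_trans yz (sup_closeC xz).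
  by move=> /(_ s); lra.
Qed.

(** A continuous function on linf need not be uniformly continuous. Comparison with
    the points of a compact set is the substitute used in limit theorems. *)
Lemma uniformly_near_compact (K : set {uniform S -> R}) (h : {uniform S -> R} -> R) e :
  compact K -> K `<=` @linf R S -> {within @linf R S, continuous h} -> 0 < e ->
  exists2 r, 0 < r & forall y z, K z -> sup_close r z y -> `|h z - h y| <= e.
Proof.
move=> cK Kl /continuous_linfP ch e0.
pose I := [set A : set {uniform S -> R} | exists2 r, 0 < r &
  forall y z, A z -> sup_close r z y -> `|h z - h y| <= e].
suff : I K by [].
apply: (compact_ideal cK).
- by exists 1.
- by move=> A B BA [r r0 hr]; exists r => // y z /BA; exact: hr.
- move=> A B [q q0 hq] [r r0 hr]; exists (Num.min q r); first by rewrite lt_min q0.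
  move=> y z [Az|Bz] zy.
    by apply: hq => //; apply: sup_closeW zy; rewrite ge_min lexx.
  by apply: hr => //; apply: sup_closeW zy; rewrite ge_min lexx orbT.
- move=> x /Kl lx.
  have e20 : 0 < e / 2 by rewrite divr_gt0.
  have [r r0 hr] := ch x lx _ e20.
  exists [set z | sup_close (r / 2) x z].
    by apply/nbhs_sup_closeP; exists (r / 2); rewrite ?divr_gt0.
  exists (r / 2) => [|y z xz zy]; first by rewrite divr_gt0.
  have r2 : r / 2 + r / 2 = r by lra.
  have hy : `|h x - h y| <= e / 2.
    by apply: hr; rewrite -r2; exact: sup_close_trans xz zy.
  have hz : `|h x - h z| <= e / 2.
    by apply: hr; apply: sup_closeW xz; lra.
  have := ler_distD (h x) (h z) (h y); rewrite (distrC (h z) (h x)); lra.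
Qed.

End sup_metric.

(** * Upper expectations and integrals of bounded functions *)

Section upper_expectation.
Context d (T : measurableType d) (R : realType) (P : probability T R).
Implicit Types (Y Z : T -> R) (B : set T).
Local Notation "'E*' Y" := (upper_expectation P Y) (at level 10, Y at level 8).

Lemma upper_expectation_ltP Y (x : \bar R) :
  (E* Y < x)%E <-> exists U : T -> \bar R, [/\ P.-integrable setT U,
     forall w, ((Y w)%:E <= U w)%E & (\int[P]_w U w < x)%E].
Proof.
split=> [/ereal_inf_lt[_ [U [iU YU] <-] Ux]|[U [iU YU Ux]]]; first by exists U.
by apply: le_lt_trans Ux; apply: ereal_inf_lbound; exists U.
Qed.

Lemma upper_expectation_mono Y Z : (forall w, Y w <= Z w) -> (E* Y <= E* Z)%E.
Proof.
move=> YZ; apply: ereal_inf_le_tmp => _ [U [iU ZU] <-].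
exists U => //; split=> // w; apply: le_trans (ZU w).
by rewrite lee_fin.
Qed.

(** Subadditivity of the upper expectation, in the form used to compare two
    processes that are close except on sets of small outer probability. *)
Lemma upper_expectation_perturb Y Z B1 B2 (x e M c : R) : 0 <= M ->
  (E* Y < x%:E)%E -> (E* \1_B1 < c%:E)%E -> (E* \1_B2 < c%:E)%E ->
  (forall w, Z w <= Y w + e + M * \1_B1 w + M * \1_B2 w) ->
  (E* Z < (x + e + M * c + M * c)%:E)%E.
Proof.
move=> M0 /upper_expectation_ltP[U [iU YU Ux]] /upper_expectation_ltP[U1 [iU1 BU1 U1c]].
move=> /upper_expectation_ltP[U2 [iU2 BU2 U2c]] ZY.
apply/upper_expectation_ltP.
have ie : P.-integrable setT (cst e%:E).
  apply: (@measurable_bounded_integrable _ _ _ P (cst e)) => //.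
    by rewrite (le_lt_trans (probability_le1 P _)) ?ltry.
  by exists `|e|; split; [exact: num_real|move=> y ey w _; exact: ltW].
have iM V : P.-integrable setT V -> P.-integrable setT (fun w => M%:E * V w)%E.
  exact: integrableZl.
exists (fun w => U w + e%:E + M%:E * U1 w + M%:E * U2 w)%E; split.
- by apply: integrableD => //; [apply: integrableD => //; [exact: integrableD|exact: iM]|exact: iM].
- move=> w; apply: (@le_trans _ _ (Y w + e + M * \1_B1 w + M * \1_B2 w)%:E).
    by rewrite lee_fin.
  rewrite !EFinD; apply: leeD; [apply: leeD; [exact: leeD|]|];
    by rewrite EFinM lee_wpmul2l // lee_fin.
rewrite integralD//=; last 2 first.
- by apply: integrableD => //; [exact: integrableD|exact: iM].
- exact: iM.
rewrite integralD//=; last 2 first.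
- exact: integrableD.
- exact: iM.
rewrite integralD// !integralZl//= integral_cst//= probability_setT mule1.
have := integrable_fin_num measurableT iU.
have := integrable_fin_num measurableT iU1.
have := integrable_fin_num measurableT iU2.
move: Ux U1c U2c.
case: (\int[P]_w U w)%E => // u; case: (\int[P]_w U1 w)%E => // u1.
case: (\int[P]_w U2 w)%E => // u2; rewrite !lte_fin => ux u1c u2c _ _ _.
have := ler_wpM2l M0 (ltW u1c); have := ler_wpM2l M0 (ltW u2c); lra.
Qed.

End upper_expectation.

Lemma bounded_by_gt0 (R : realType) (X : Type) (h : X -> R) :
  [bounded h z | z in setT] -> exists2 M : R, 0 < M & forall z, `|h z| <= M.
Proof.
move=> [M [_ hM]]; exists (`|M| + 1) => [|z]; first by rewrite ltr_pwDr.
by apply: (hM (`|M| + 1)) => //; rewrite (le_lt_trans (ler_norm M))// ltrDl.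
Qed.

Section bounded_expectation.
Context d (T : measurableType d) (R : realType) (P : probability T R).
Implicit Types (Y Z : T -> R).

Lemma bounded_integrable Y M : measurable_fun setT Y -> (forall w, `|Y w| <= M) ->
  P.-integrable setT (EFin \o Y).
Proof.
move=> mY YM; apply: measurable_bounded_integrable => //.
  by rewrite (le_lt_trans (probability_le1 P _)) ?ltry.
exists M; split; first exact: num_real.
by move=> y My w _; apply: le_trans (YM w) (ltW My).
Qed.

Lemma expectationE Y : P.-integrable setT (EFin \o Y) ->
  ('E_P[Y] = (\int[P]_w Y w)%R%:E)%E.
Proof. by move=> iY; rewrite unlock fineK//; exact: integrable_fin_num. Qed.

(** By integrating the bound |Y - Z| <= e + 2 M 1_N. *)
Lemma Rintegral_close Y Z (N : set T) (e M c : R) : 0 <= e -> 0 <= M ->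
  measurable_fun setT Y -> measurable_fun setT Z ->
  (forall w, `|Y w| <= M) -> (forall w, `|Z w| <= M) ->
  measurable N -> (P N <= c%:E)%E ->
  (forall w, ~ N w -> `|Y w - Z w| <= e) ->
  `|\int[P]_w Y w - \int[P]_w Z w| <= e + 2 * M * c.
Proof.
move=> e0 M0 mY mZ YM ZM mN PN YZ.
have iY := bounded_integrable mY YM; have iZ := bounded_integrable mZ ZM.
rewrite -RintegralB//.
have mYZ : measurable_fun setT (Y \- Z) by exact: measurable_funB.
have YZM w : `|(Y \- Z) w| <= 2 * M.
  by apply: le_trans (ler_normB _ _) _; have := YM w; have := ZM w; lra.
have iYZ := bounded_integrable mYZ YZM.
apply: le_trans (le_normr_Rintegral _ _) _ => //.
pose D w : R := e + 2 * M * \1_N w.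
have mD : measurable_fun setT D.
  by apply: measurable_funD => //; apply: measurable_funM => //; exact: measurable_indic.
have iD : P.-integrable setT (EFin \o D).
  apply: (@bounded_integrable _ (e + 2 * M)) => // w; rewrite /D indicE ger0_norm.
    by case: (w \in N) => /=; lra.
  by case: (w \in N) => /=; lra.
apply: (@le_trans _ _ (\int[P]_w D w)).
  apply: le_Rintegral => //.
    exact: integrable_norm.
  move=> w _; rewrite /D indicE; have [wN|nN] := pselect (N w).
    by rewrite mem_set//=; have := YZM w => /=; lra.
  by rewrite memNset//=; have := YZ w nN; lra.
have i1 : P.-integrable setT (EFin \o cst e).
  by apply: (@bounded_integrable _ `|e|).
have iN : P.-integrable setT (EFin \o (\1_N : T -> R)).
  apply: (@bounded_integrable _ 1) => [|w]; first exact: measurable_indic.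
  by rewrite indicE; case: (w \in N) => /=; rewrite ?normr1 ?normr0.
rewrite /D RintegralD//; last first.
  apply: (@bounded_integrable _ (2 * M)) => [|w].
    by apply: measurable_funM => //; exact: measurable_indic.
  by rewrite indicE ger0_norm; case: (w \in N) => /=; lra.
have P1 : fine (P setT) = 1 by rewrite probability_setT.
rewrite Rintegral_cst// P1 mulr1 RintegralZl//.
rewrite lerD2l ler_wpM2l//; first lra.
rewrite /Rintegral integral_indic// setIT -lee_fin fineK//.
exact: fin_num_measure.
Qed.

End bounded_expectation.

(** * Random functions with a Radon law *)

Section radon.
Context d (T : measurableType d) (R : realType) (P : probability T R).
Context (S : choiceType).
Implicit Types (V : S -> T -> R) (h : {uniform S -> R} -> R).

Lemma path_measurable_preimage V (A : set {uniform S -> R}) :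
  radon_law_linf P V -> open A -> measurable [set w | A (V ^~ w)].
Proof. by move=> [_ mV _] oA; apply: (mV A); exact: sub_gen_smallest. Qed.

(** Outside linf the function h is arbitrary; but paths are in linf, which is
    open, so only the trace of h^-1(U) on linf matters, and it is open. *)
Lemma measurable_comp_path V h : radon_law_linf P V ->
  {within @linf R S, continuous h} -> measurable_fun setT (fun w => h (V ^~ w)).
Proof.
move=> rV; rewrite continuous_open_subspace; last exact: open_linf.
move/(continuous_inP h (@open_linf R S)) => ch.
apply: (measurability _ (RGenOpens.measurableE R)) => _ [_ [a [b ->]] <-].
rewrite setTI.
have := path_measurable_preimage rV (ch `]a, b[%classic (interval_open _ _)).
rewrite (_ : mkset _ = (fun w => h (V ^~ w)) @^-1` `]a, b[%classic); last first.
  apply/seteqP; split => [w []//|w /= haw]; split => //.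
  by case: rV => + _ _; exact.
by apply.
Qed.

Lemma radon_compact V e : radon_law_linf P V -> 0 < e ->
  exists K : set {uniform S -> R}, [/\ compact K, K `<=` @linf R S,
    measurable [set w | ~ K (V ^~ w)] & (P [set w | ~ K (V ^~ w)] < e%:E)%E].
Proof.
move=> rV e0; case: (rV) => lV _ /(_ (@linf R S)).
have ol : uborel (@linf R S) by have := @open_linf R S; exact: sub_gen_smallest.
move=> /(_ ol e e0) [K [cK Kl PK]]; exists K; split => //.
  exact: (path_measurable_preimage rV (compact_closed_sup cK)).
congr (_ < _)%E : PK; congr (P _).
by apply/seteqP; split => [w []|w nK] //; split => //; exact: lV.
Qed.

End radon.

(** * Stability of weak convergence *)

Lemma cvg_EFinP (R : realType) (u : nat -> \bar R) (v : R) :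
  u n @[n --> \oo] --> v%:E <->
  (forall e, 0 < e -> \forall n \near \oo, ((v - e)%:E < u n < (v + e)%:E)%E).
Proof.
split=> [uv e e0|H A].
  have h1 : nbhs v%:E [set y | (y < (v + e)%:E)%E].
    by apply: open_ereal_lt'; rewrite lte_fin ltrDl.
  have h2 : nbhs v%:E [set y | ((v - e)%:E < y)%E].
    by apply: open_ereal_gt'; rewrite lte_fin ltrBlDr ltrDl.
  near=> n; apply/andP; split; near: n; [exact: uv h2|exact: uv h1].
move=> nA; have : nbhs v [set r | A r%:E] by exact: nA.
move=> /nbhs_ballP[e /= e0 eA]; have := H e e0; apply: filterS => n /=.
case: (u n) => [r||] /andP[]; rewrite ?lte_fin ?ltNge ?leey ?leNye// -!ltNge => r1 r2; apply: eA.
by rewrite /ball /= ltr_norml; apply/andP; split; lra.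
Unshelve. all: by end_near. Qed.

(** lra reads every order hypothesis of the context and stops at those between
    extended reals; these are dropped first. *)
Ltac rlra := repeat match goal with
  | H : is_true (@Order.lt ereal_display _ _ _) |- _ => clear H
  | H : is_true (@Order.le ereal_display _ _ _) |- _ => clear H
  end; lra.

Section clt_stability.
Context d (T : measurableType d) (R : realType) (P : probability T R).

(** A portmanteau inequality: if the limit is in A up to probability c, then
    eventually V_n is near A up to outer probability c. The test function is
    min(1, dist(z, A) / r), which vanishes on A and is 1 at distance r from it. *)
Lemma clt_outer_near (S : choiceType) (V_ : nat -> S -> T -> R) (V : S -> T -> R)
    (A : set {uniform S -> R}) (N : set T) (c r : R) :
  clt_linf P V_ V -> measurable N -> (P N < c%:E)%E ->
  (forall w, ~ N w -> A (V ^~ w)) -> 0 < r ->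
  \forall n \near \oo, (upper_expectation P
    \1_[set w | ~ exists2 y, A y & sup_close r (V_ n ^~ w) y] < c%:E)%E.
Proof.
move=> [gV rV cltV] mN PN NA r0.
(* dist_set is truncated at 1, so it sees only radii at most 1 *)
pose q := Num.min r 1.
have q0 : 0 < q by rewrite lt_min r0 ltr01.
have q1 : q <= 1 by rewrite ge_min lexx orbT.
have qr : q <= r by rewrite ge_min lexx.
pose h (z : {uniform S -> R}) : R := Num.min 1 (dist_set A z / q).
have h0 z : 0 <= h z by rewrite le_min ler01 divr_ge0 ?dist_set_ge0 ?ltW.
have h1 z : h z <= 1 by rewrite ge_min lexx.
have bh : [bounded h z | z in setT].
  exists 1; split; first exact: num_real.
  by move=> x x1 z _ /=; rewrite ger0_norm// (le_trans (h1 z))// ltW.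
have ch : {within @linf R S, continuous h}.
  apply: (@lipschitz_continuous_linf _ _ h q^-1); first by rewrite invr_gt0.
  move=> e y z e0 yz; have := dist_set_lipschitz A e0 yz.
  rewrite -(ler_pM2r (_ : 0 < q^-1)) ?invr_gt0// mulrDl (mulrC e).
  rewrite /h; have qe : 0 <= q^-1 * e by rewrite mulr_ge0 ?invr_ge0 ?ltW.
  case: (leP 1 (dist_set A y / q)) => ?; case: (leP 1 (dist_set A z / q)) => ?; rlra.
have := cltV h bh ch.
have Eh : ('E_P[fun w => h (V ^~ w)] < c%:E)%E.
  apply: le_lt_trans PN; rewrite -(expectation_indic P mN).
  apply: expectation_le => //.
  - exact: measurable_comp_path rV ch.
  - apply/aeW => w; rewrite indicE; have [wN|nN] := pselect (N w).
      by rewrite mem_set.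
    rewrite memNset//= /h ge_min; apply/orP; right.
    rewrite (_ : dist_set A _ = 0) ?mul0r//; apply/eqP.
    rewrite eq_le dist_set_ge0 andbT; apply: (@dist_set_le _ _ _ _ (V ^~ w)) => //.
      exact: NA.
    exact: sup_closexx.
move=> cv.
have : \forall n \near \oo, (upper_expectation P (fun w => h (V_ n ^~ w)) < c%:E)%E.
  exact: cv (open_ereal_lt' Eh).
apply: filterS => n /=; apply: le_lt_trans.
apply: upper_expectation_mono => w; rewrite indicE.
have [wB|nB] := pselect ([set w | ~ exists2 y, A y & sup_close r (V_ n ^~ w) y] w).
  rewrite mem_set//= /h le_min lexx ler_pdivlMr// mul1r.
  rewrite leNgt; apply/negP => /(dist_set_lt q1)[y Ay zy]; apply: wB.
  by exists y => //; exact: sup_closeW zy.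
by rewrite memNset.
Qed.

(** Outside a set of small outer probability, U_n is near a compact set K that
    carries most of the limit law, and W_n is close to U_n; there h(W_n) and
    h(U_n) are both close to the value of h at a common point of K. *)
Lemma clt_slutsky (S : choiceType) (U_ W_ : nat -> S -> T -> R) (V : S -> T -> R) :
  clt_linf P U_ V ->
  (forall r c : R, 0 < r -> 0 < c -> \forall n \near \oo, (upper_expectation P
     \1_[set w | ~ sup_close r (W_ n ^~ w) (U_ n ^~ w)] < c%:E)%E) ->
  clt_linf P W_ V.
Proof.
move=> cltU UW; case: (cltU) => gV rV cU; split=> // h bh ch.
have [M M0 hM] := bounded_by_gt0 bh.
have iV := bounded_integrable P (measurable_comp_path rV ch) (fun w => hM (V ^~ w)).
have := cU h bh ch; rewrite (expectationE iV) => /cvg_EFinP cUh.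
set v := Rintegral _ _ _ in cUh *.
apply/cvg_EFinP => e e0.
(* the final error is at most 4 a + 4 M a *)
pose a := e / (4 + 4 * M).
have a0 : 0 < a by rewrite divr_gt0//; rlra.
have ea : e = a * (4 + 4 * M) by rewrite divfK// gt_eqF//; rlra.
have [K [cK Kl mK PK]] := radon_compact rV a0.
have [r r0 hr] := uniformly_near_compact cK Kl ch a0.
have r20 : 0 < r / 2 by rewrite divr_gt0.
have H1 := clt_outer_near cltU mK PK (A := K) (fun w => @contrapT _) r20.
have H2 := UW _ _ r20 a0.
have H3 := cUh a a0.
apply: filterS3 H1 H2 H3 => n.
set B1 := [set w | ~ exists2 y, _ & _]; set B2 := [set w | ~ sup_close _ _ _].
move=> B1a B2a /andP[Ul Uu].
have close w : `|h (W_ n ^~ w) - h (U_ n ^~ w)| <= 2 * a + 2 * M * \1_B1 w + 2 * M * \1_B2 w.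
  have b0 (B : set T) : 0 <= 2 * M * \1_B w :> R.
    by rewrite indicE; case: (w \in B) => /=; rlra.
  have := b0 B1; have := b0 B2.
  have trivial_bound : `|h (W_ n ^~ w) - h (U_ n ^~ w)| <= 2 * M.
    apply: le_trans (ler_normB _ _) _.
    by have := hM (W_ n ^~ w); have := hM (U_ n ^~ w); rlra.
  have [wB1|/contrapT[y Ky Uy]] := pselect (B1 w).
    by rewrite (_ : \1_B1 w = 1)//; [rlra|rewrite indicE mem_set].
  have [wB2|/contrapT WU] := pselect (B2 w).
    by rewrite (_ : \1_B2 w = 1)//; [rlra|rewrite indicE mem_set].
  have yU : `|h y - h (U_ n ^~ w)| <= a.
    by apply: hr => //; apply: sup_closeC; apply: sup_closeW Uy; rlra.
  have yW : `|h y - h (W_ n ^~ w)| <= a.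
    apply: hr => //; apply: sup_closeC.
    have := sup_close_trans WU Uy; apply: sup_closeW; rlra.
  have := ler_distD (h y) (h (W_ n ^~ w)) (h (U_ n ^~ w)).
  rewrite (distrC (h (W_ n ^~ w)) (h y)); rlra.
have M20 : 0 <= 2 * M by rlra.
apply/andP; split; last first.
  have := upper_expectation_perturb (Z := fun w => h (W_ n ^~ w)) (e := 2 * a) M20 Uu B1a B2a.
  move=> /(_ _)/lt_le_trans; apply.
    by move=> w; have := close w; rewrite ler_norml => /andP[_]; rlra.
  by rewrite lee_fin ea; rlra.
rewrite ltNge; apply/negP => Wl.
have Wl' : (upper_expectation P (fun w => h (W_ n ^~ w)) < (v - e + a)%:E)%E.
  by apply: le_lt_trans Wl _; rewrite lte_fin; rlra.
have := upper_expectation_perturb (Z := fun w => h (U_ n ^~ w)) (e := 2 * a) M20 Wl' B1a B2a.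
have cl' w : h (U_ n ^~ w) <= h (W_ n ^~ w) + 2 * a + 2 * M * \1_B1 w + 2 * M * \1_B2 w.
  by have := close w; rewrite ler_norml => /andP[]; rlra.
move=> /(_ cl') /(lt_trans Ul).
rewrite lte_fin ea; rlra.
Qed.

(** Continuous mapping for z |-> m * (z o phi), which is linear and bounded for the
    sup-norm; the image of a compact set under it is compact, so Radon laws are
    preserved. *)
Lemma clt_reweight (S S' : choiceType) (V_ : nat -> S -> T -> R) (V : S -> T -> R)
    (phi : S' -> S) (m : S' -> R) (C : R) :
  (forall s, `|m s| <= C) -> clt_linf P V_ V ->
  clt_linf P (fun n s w => m s * V_ n (phi s) w) (fun s w => m s * V (phi s) w).
Proof.
move=> mC [gV rV cV].
pose C1 := `|C| + 1.
have C10 : 0 < C1 by rewrite ltr_pwDr.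
have mC1 s : `|m s| <= C1.
  by apply: le_trans (mC s) _; rewrite (le_trans (ler_norm C))// lerDl.
pose Psi (z : {uniform S -> R}) : {uniform S' -> R} := fun s => m s * z (phi s).
have PsiL r y z : sup_close r y z -> sup_close (C1 * r) (Psi y) (Psi z).
  move=> yz s; rewrite /Psi -mulrBr normrM ler_pM//; exact: yz.
have PsiLr r y z : sup_close (r / C1) y z -> sup_close r (Psi y) (Psi z).
  by move=> /PsiL; rewrite mulrC divfK// gt_eqF.
have cPsi : continuous Psi.
  move=> z A /nbhs_sup_closeP[e e0 eA]; apply/nbhs_sup_closeP.
  by exists (e / C1) => [|y zy]; [rewrite divr_gt0|apply: eA; exact: PsiLr].
have linfPsi z : linf z -> linf (Psi z).
  move=> /linfP[M zM]; apply/linfP; exists (C1 * M) => s.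
  by rewrite normrM ler_pM.
case: (rV) => lV mV KV.
have uPsi B : uborel B -> uborel (Psi @^-1` B).
  move=> uB.
  have sP := sigma_algebra_image Psi (smallest_sigma_algebra setT [set U : set {uniform S -> R} | open U]).
  rewrite -[Psi @^-1` B]setTI; apply: (smallest_sub sP _ uB) => A oA.
  rewrite /image_set_system /= setTI; apply: sub_gen_smallest.
  by apply: open_comp => // z _; exact: cPsi.
split.
- move=> k s c.
  have := gV k (fun j => phi (s j)) (fun j => c j * m (s j)).
  by congr (centered_gaussian_rv _ _); apply/funext => w; apply: eq_bigr => j _; rewrite mulrA.
- split.
  + by move=> w; exact: (linfPsi _ (lV w)).
  + by move=> B /uPsi /mV.
  + move=> B uB e e0; have [K [cK KB PK]] := KV _ (uPsi _ uB) e e0.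
    have cPK : compact (Psi @` K).
      by apply: continuous_compact => //; exact: continuous_subspaceT.
    exists (Psi @` K); split => //.
      by move=> _ [z Kz <-]; exact: KB.
    apply: le_lt_trans PK; apply: le_measure; rewrite ?inE.
    * have mB := mV _ (uPsi _ uB).
      have oPK : uborel (~` (Psi @` K)) by exact: sub_gen_smallest (compact_closed_sup cPK).
      exact: (measurableI _ _ mB (mV _ (uPsi _ oPK))).
    * exact: (measurableI _ _ (mV _ (uPsi _ uB))
        (path_measurable_preimage rV (compact_closed_sup cK))).
    * by move=> w [Bw nK]; split => // Kw; apply: nK; exists (V ^~ w).
- move=> h [M [_ bh]] ch.
  apply: (cV (h \o Psi)).
    by exists M; split; [exact: num_real|move=> x Mx z _; exact: (bh x Mx (Psi z) I)].
  apply/continuous_linfP => z /linfPsi lz e e0.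
  have /continuous_linfP/(_ _ lz e e0)[r r0 hr] := ch.
  exists (r / C1) => [|y zy]; first by rewrite divr_gt0.
  by apply: hr; exact: PsiLr.
Qed.

End clt_stability.

(** * Symmetry of one-dimensional centered Gaussian laws *)

Section symmetric_rv.
Variable R : realType.

Lemma normal_prob_opp (s : R) (B : set R) : s != 0 -> measurable B ->
  normal_prob 0 s (-%R @^-1` B) = normal_prob 0 s B.
Proof.
move=> s0 mB; rewrite /normal_prob.
transitivity (\int[pushforward (@lebesgue_measure R) (-%R : _ -> measurableTypeR R)]_(x in B) (normal_pdf 0 s x)%:E)%E; last first.
  apply: eq_measure_integral => A mA _; exact: lebesgue_measureN.
rewrite ge0_integral_pushforward//=; last 2 first.
- apply/measurable_EFinP/(measurable_funS measurableT (@subsetT _ _)).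
  exact: measurable_normal_pdf.
- by move=> y _; rewrite lee_fin normal_pdf_ge0.
apply: eq_integral => x _ /=; congr EFin.
by rewrite !normal_pdfE// /normal_fun !subr0 sqrrN.
Qed.

End symmetric_rv.

Section symmetric_expectation.
Context d (T : measurableType d) (R : realType) (P : probability T R).

Lemma centered_gaussian_rv_opp (Y : T -> R) (B : set R) :
  centered_gaussian_rv P Y -> measurable B -> P (Y @^-1` (-%R @^-1` B)) = P (Y @^-1` B).
Proof.
move=> [mY HY] mB.
have mNB : measurable (-%R @^-1` B : set R).
  by rewrite -[X in measurable X]setTI; apply: (@oppr_measurable R) => //.
case: HY => [HY|[s s0 HY]]; rewrite !HY//.
  rewrite !diracE (_ : (0 \in -%R @^-1` B) = (0 \in B))//.
  by apply/idP/idP; rewrite !inE/= oppr0.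
by rewrite normal_prob_opp// gt_eqF.
Qed.

(** Y and -Y have the same law. *)
Lemma gaussian_expectation_opp (Y : T -> R) (phi : R -> R) (M : R) :
  centered_gaussian_rv P Y -> measurable_fun setT phi -> (forall x, `|phi x| <= M) ->
  \int[P]_w phi (Y w) = \int[P]_w phi (- Y w).
Proof.
move=> gY mphi phiM; have mY := gY.1.
have mNY : measurable_fun setT (fun w => - Y w) by exact: measurable_funN.
rewrite /Rintegral; congr fine.
have h1 : P.-integrable setT ((EFin \o phi) \o Y).
  by apply: (bounded_integrable P (M := M)) => [|w]; [exact: measurableT_comp|exact: phiM].
have h2 : P.-integrable setT ((EFin \o phi) \o (fun w => - Y w)).
  by apply: (bounded_integrable P (M := M)) => [|w]; [exact: measurableT_comp|exact: phiM].
have mphi' : measurable_fun setT (EFin \o phi) by exact/measurable_EFinP.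
have e1 := @integral_pushforward _ _ _ _ R _ mY P setT _ mphi' h1 measurableT.
have e2 := @integral_pushforward _ _ _ _ R _ mNY P setT _ mphi' h2 measurableT.
rewrite !preimage_setT in e1 e2.
apply: (eq_trans (esym e1)); apply: (eq_trans _ e2).
apply: eq_measure_integral => A mA _; rewrite /pushforward.
exact/esym/(centered_gaussian_rv_opp gY).
Qed.

End symmetric_expectation.

(** * Approximation by trigonometric polynomials *)

(** The lattice form of the Stone-Weierstrass theorem. For fixed x, the functions
    that agree with h at x and at a second point are combined by maxima into one
    that agrees with h at x and exceeds h - e on K; these are then combined by
    minima. Both combinations are instances of compact_ideal. *)
Lemma lattice_approximation (X : topologicalType) (R : realType) (K : set X)
    (L : set (X -> R)) (h : X -> R) (e : R) :
  compact K -> 0 < e -> L !=set0 ->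
  (forall g k, L g -> L k -> L (fun z => Num.max (g z) (k z))) ->
  (forall g k, L g -> L k -> L (fun z => Num.min (g z) (k z))) ->
  (forall x y, K x -> K y -> exists2 g, L g & g x = h x /\ g y = h y) ->
  (forall g x r, L g -> K x -> 0 < r ->
     nbhs x [set z | `|(g z - h z) - (g x - h x)| <= r]) ->
  exists2 g, L g & forall z, K z -> `|g z - h z| <= e.
Proof.
move=> cK e0 [g0 Lg0] Lmax Lmin Lsep Lcont.
have above x : K x -> exists2 g, L g /\ g x = h x & forall z, K z -> h z - e <= g z.
  move=> Kx.
  pose I (A : set X) := exists2 g, L g /\ g x = h x & forall z, A z -> h z - e <= g z.
  apply: (@compact_ideal _ K I cK).
  - by have [g Lg [gx _]] := Lsep x x Kx Kx; exists g => // z [].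
  - by move=> A B BA [g Lg gA]; exists g => // z /BA; exact: gA.
  - move=> A B [g [Lg gx] gA] [k [Lk kx] kB].
    exists (fun z => Num.max (g z) (k z)); first by split; [exact: Lmax|rewrite gx kx maxxx].
    by move=> z [/gA|/kB]; rewrite le_max => ->; rewrite ?orbT.
  - move=> y Ky; have [g Lg [gx gy]] := Lsep x y Kx Ky.
    exists [set z | `|(g z - h z) - (g y - h y)| <= e]; first exact: Lcont.
    by exists g => // z /=; rewrite gy subrr subr0 ler_norml; lra.
have [[x0 Kx0]|nK] := pselect (K !=set0); last first.
  by exists g0 => // z Kz; exfalso; apply: nK; exists z.
pose I (A : set X) := exists2 g, L g /\ (forall z, K z -> h z - e <= g z) &
  forall z, A z -> g z <= h z + e.
have [|A B BA [g Lg gA]|A B [g [Lg gK] gA] [k [Lk kK] kB]|x Kx|g [Lg gK] gA] := @compact_ideal _ K I cK.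
- by have [g [Lg _] gK] := above x0 Kx0; exists g => // z [].
- by exists g => // z /BA; exact: gA.
- exists (fun z => Num.min (g z) (k z)).
    by split; [exact: Lmin|move=> z Kz; rewrite le_min gK ?kK].
  by move=> z [/gA|/kB]; rewrite ge_min => ->; rewrite ?orbT.
- have [g [Lg gx] gK] := above x Kx.
  exists [set z | `|(g z - h z) - (g x - h x)| <= e]; first exact: Lcont.
  by exists g => // z /=; rewrite gx subrr subr0 ler_norml; lra.
- by exists g => // z Kz; have := gK z Kz; have := gA z Kz; rewrite ler_norml; lra.
Qed.

Section absolute_value_approximation.
Variable R : realType.

(** Polynomials in x converging to |x| uniformly on [-1, 1]. They are obtained by
    the iteration r |-> r + (x^2 - r^2) / 2, whose fixed points are |x| and -|x|
    and which increases to |x| from 0; only ring operations occur in it, so an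
    algebra of functions is stable under it. *)
Fixpoint abs_approx (k : nat) (x : R) : R :=
  if k is k'.+1 then abs_approx k' x + (x ^+ 2 - abs_approx k' x ^+ 2) / 2 else 0.

(** With y = |x| and r = abs_approx k x, one step multiplies the error y - r by
    1 - (y + r) / 2 <= 1 - y / 2, and (1 - y / 2)^k (1 + k y / 2) <= 1. The middle
    conjunct is the resulting invariant; it gives an error at most 2 / k. *)
Lemma abs_approxP k (x : R) : `|x| <= 1 ->
  0 <= abs_approx k x /\ (`|x| - abs_approx k x) * (1 + k%:R * (`|x| / 2)) <= `|x|
  /\ abs_approx k x <= `|x|.
Proof.
move=> x1; have x2 : x ^+ 2 = `|x| ^+ 2 by rewrite real_normK// num_real.
elim: k => [|k [r0 [ur rx]]] /=; first by rewrite subr0 mul0r addr0 mulr1 !lexx.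
rewrite x2; move: r0 ur rx (normr_ge0 x) x1; clear x2.
move: (abs_approx k x) `|x| => r y r0 ur rx y0 y1.
have k0 : 0 <= k%:R :> R by [].
have uE : y - (r + (y ^+ 2 - r ^+ 2) / 2) = (y - r) * (1 - (y + r) / 2) by field.
have u0 : 0 <= y - r by lra.
split; [nra|split; last first].
  by rewrite -subr_ge0 uE mulr_ge0//; lra.
have kE : k.+1%:R = k%:R + 1 :> R by rewrite natr1.
rewrite uE kE; apply: le_trans ur.
rewrite -mulrA ler_wpM2l//.
have : 0 <= k%:R * (y / 2) by rewrite mulr_ge0 ?divr_ge0.
rewrite (mulrDl k%:R) mul1r; move: (k%:R * (y / 2)) => q q0.
have yr0 : 0 <= y + r by rewrite addr_ge0.
have := mulr_ge0 yr0 q0; have := mulr_ge0 yr0 y0; lra.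
Qed.

Lemma abs_approx_close k (x : R) : `|x| <= 1 -> `| `|x| - abs_approx k.+1 x| <= 2 / k.+1%:R.
Proof.
move=> x1; have [r0 [ur rx]] := abs_approxP k.+1 x1.
rewrite ger0_norm ?subr_ge0// ler_pdivlMr//.
have := normr_ge0 x; rewrite le_eqVlt => /predU1P[x0|x0].
  have -> : abs_approx k.+1 x = 0 by lra.
  by rewrite -x0 subrr mul0r.
rewrite -(ler_pM2r x0); have := ler_norm x; set u := _ - _ in ur *.
have u0 : 0 <= u by rewrite subr_ge0.
move: ur; set n : R := k.+1%:R; nra.
Qed.

End absolute_value_approximation.

Section trigonometric_polynomials.
Variables (R : realType) (S : choiceType).
Implicit Types (g h : {uniform S -> R} -> R) (l : seq (R * S)).

(** A list of terms, so that concatenation is addition. *)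
Definition linear_form l (z : S -> R) : R := \sum_(p <- l) p.1 * z p.2.

(** The phase theta covers sines and makes a product of generators a combination of
    generators. A single linear form occurs under each cosine, so that
    expectations depend only on the laws of linear combinations. *)
Inductive trig_poly : ({uniform S -> R} -> R) -> Prop :=
| trig_cos l theta : trig_poly (fun z => cos (linear_form l z + theta))
| trig_add g h : trig_poly g -> trig_poly h -> trig_poly (fun z => g z + h z)
| trig_scale a g : trig_poly g -> trig_poly (fun z => a * g z).

Lemma trig_cst a : trig_poly (fun=> a).
Proof.
rewrite (_ : (fun=> a) = fun z : {uniform S -> R} => a * cos (linear_form [::] z + 0)).
  by apply: trig_scale; exact: trig_cos.
by apply/funext => z; rewrite /linear_form big_nil addr0 cos0 mulr1.
Qed.

(** On the generators, this is the product-to-sum formula for cosines. *)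
Lemma trig_mul g h : trig_poly g -> trig_poly h -> trig_poly (fun z => g z * h z).
Proof.
move=> tg th; elim: tg => [l theta|g1 g2 _ IH1 _ IH2|a g1 _ IH].
- elim: th => [l' theta'|h1 h2 _ IH1 _ IH2|a h1 _ IH].
  + pose m := [seq (- p.1, p.2) | p <- l'].
    rewrite (_ : (fun z => _) = fun z : {uniform S -> R} =>
      2^-1 * (cos (linear_form (l ++ l') z + (theta + theta')) +
              cos (linear_form (l ++ m) z + (theta - theta')))).
      by apply: trig_scale; apply: trig_add; exact: trig_cos.
    apply/funext => z.
    have mE : linear_form m z = - linear_form l' z.
      rewrite /linear_form big_map -sumrN; apply: eq_bigr => p _ /=.
      by rewrite mulNr.
    have catE l1 l2 : linear_form (l1 ++ l2) z = linear_form l1 z + linear_form l2 z.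
      by rewrite /linear_form big_cat.
    rewrite !catE mE; move: (linear_form l z) (linear_form l' z) => u v.
    rewrite (_ : u + v + _ = (u + theta) + (v + theta')); last by ring.
    rewrite (_ : u - v + _ = (u + theta) - (v + theta')); last by ring.
    by rewrite (cosD (u + theta) (v + theta')) (cosB (u + theta) (v + theta')); field.
  + under [X in trig_poly X]eq_fun do rewrite mulrDr; exact: trig_add.
  + under [X in trig_poly X]eq_fun do rewrite mulrCA; exact: trig_scale.
- under [X in trig_poly X]eq_fun do rewrite mulrDl; exact: trig_add.
- under [X in trig_poly X]eq_fun do rewrite -mulrA; exact: trig_scale.
Qed.

Lemma trig_bounded g : trig_poly g -> exists2 M : R, 0 < M & forall z, `|g z| <= M.
Proof.
elim => [l theta|g1 g2 _ [M M0 gM] _ [N N0 hN]|a g1 _ [M M0 gM]].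
- by exists 1 => // z; exact: cos_max.
- exists (M + N) => [|z]; first exact: addr_gt0.
  by apply: le_trans (ler_normD _ _) _; exact: lerD.
- exists ((`|a| + 1) * M) => [|z]; first by rewrite mulr_gt0// ltr_pwDr.
  by rewrite normrM ler_pM// lerDl.
Qed.

Lemma continuous_linear_form l : continuous (linear_form l : {uniform S -> R} -> R).
Proof.
elim: l => [|p l IH] z.
  rewrite (_ : linear_form _ = fun=> 0); first exact: cst_continuous.
  by apply/funext => y; rewrite /linear_form big_nil.
rewrite (_ : linear_form _ = fun y => p.1 * y p.2 + linear_form l y); last first.
  by apply/funext => y; rewrite /linear_form big_cons.
apply: (@continuousD _ _ _ (fun y : {uniform S -> R} => p.1 * y p.2)); last exact: IH.
apply: (@continuousM _ _ (fun=> p.1)); first exact: cst_continuous.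
move=> A /nbhs_ballP[e /= e0 eA]; apply/nbhs_sup_closeP.
exists (e / 2) => [|y zy]; first by rewrite divr_gt0.
by apply: eA; rewrite /ball /=; apply: le_lt_trans (zy p.2) _; lra.
Qed.

Lemma trig_continuous g : trig_poly g -> continuous g.
Proof.
elim => [l theta|g1 g2 _ c1 _ c2|a g1 _ c1] z.
- apply: (@continuous_comp _ _ _ (fun z : {uniform S -> R} => linear_form l z + theta) cos).
    apply: (@continuousD _ _ _ (linear_form l : {uniform S -> R} -> R) (fun=> theta)).
      exact: continuous_linear_form.
    exact: cst_continuous.
  exact: continuous_cos.
- by apply: (@continuousD _ _ _ g1 g2); [exact: c1|exact: c2].
- by apply: (@continuousM _ _ (fun=> a) g1); [exact: cst_continuous|exact: c1].
Qed.

(** The approximation is uniform on the whole space and not only on a compact set: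
    this keeps a global bound on the approximants, which is needed when they are
    integrated. *)
Definition trig_closure g :=
  forall e : R, 0 < e -> exists2 p, trig_poly p & forall z, `|g z - p z| <= e.

Lemma trig_closure_poly g : trig_poly g -> trig_closure g.
Proof. by move=> tg e e0; exists g => // z; rewrite subrr normr0 ltW. Qed.

Lemma trig_closureD g h : trig_closure g -> trig_closure h -> trig_closure (fun z => g z + h z).
Proof.
move=> cg ch e e0; have e20 : 0 < e / 2 by rewrite divr_gt0.
have [p tp gp] := cg _ e20; have [q tq hq] := ch _ e20.
exists (fun z => p z + q z); first exact: trig_add.
by move=> z; rewrite opprD addrACA; apply: le_trans (ler_normD _ _) _;
  have := gp z; have := hq z; lra.
Qed.

Lemma trig_closureZ a g : trig_closure g -> trig_closure (fun z => a * g z).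
Proof.
move=> cg e e0; have a0 : 0 < `|a| + 1 by rewrite ltr_pwDr.
have [p tp gp] := cg _ (divr_gt0 e0 a0).
exists (fun z => a * p z); first exact: trig_scale.
move=> z; rewrite -mulrBr normrM; have := gp z; rewrite ler_pdivlMr// mulrC; apply: le_trans.
by rewrite ler_wpM2r// lerDl.
Qed.

Lemma trig_abs_approx p k : trig_poly p -> trig_poly (fun z => abs_approx k (p z)).
Proof.
move=> tp; elim: k => [|k IH] /=; first exact: trig_cst.
apply: trig_add => //.
under [X in trig_poly X]eq_fun do rewrite mulrC.
apply: trig_scale; under [X in trig_poly X]eq_fun do rewrite !expr2 -mulN1r.
by apply: trig_add; [exact: trig_mul|apply: trig_scale; exact: trig_mul].
Qed.

Lemma trig_closure_abs g : trig_closure g -> trig_closure (fun z => `|g z|).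
Proof.
move=> cg e e0; have e20 : 0 < e / 2 by rewrite divr_gt0.
have [p tp gp] := cg _ e20.
have [M M0 pM] := trig_bounded tp.
(* the error M * 2 / k.+1 has to be at most e / 2 *)
pose k := Num.truncn (4 * M / e).
exists (fun z => M * abs_approx k.+1 (M^-1 * p z)).
  by apply: trig_scale; apply: (trig_abs_approx (p := fun z => M^-1 * p z)); exact: trig_scale.
move=> z; have Mp : `|M^-1 * p z| <= 1.
  by rewrite normrM gtr0_norm ?invr_gt0// mulrC ler_pdivrMr// mul1r.
have := abs_approx_close k Mp.
rewrite -(ler_pM2l M0) -{1}(gtr0_norm M0) -normrM mulrBr -{1}(gtr0_norm M0) -normrM.
rewrite mulVKf ?gt_eqF// => Hk.
have kM : M * (2 / k.+1%:R) <= e / 2.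
  have : 4 * M / e < k.+1%:R.
    exact: truncnS_gt.
  rewrite ltr_pdivrMr// mulrA ler_pdivrMr//; lra.
have := ler_dist_dist (g z) (p z); have := gp z.
have := ler_distD `|p z| `|g z| (M * abs_approx k.+1 (M^-1 * p z)).
move=> h1 h2 h3; apply: (le_trans h1); apply: (@le_trans _ _ (e / 2 + e / 2)); last lra.
by apply: lerD; [exact: le_trans h3 h2|exact: le_trans Hk kM].
Qed.

Lemma trig_closure_max g h : trig_closure g -> trig_closure h ->
  trig_closure (fun z => Num.max (g z) (h z)).
Proof.
move=> cg ch; rewrite (_ : (fun z => _) =
  fun z => 2^-1 * ((g z + h z) + `|g z + -1 * h z|)).
  apply: trig_closureZ; apply: trig_closureD; first exact: trig_closureD.
  by apply: trig_closure_abs; apply: trig_closureD => //; exact: trig_closureZ.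
apply/funext => z; rewrite mulN1r; case: (leP (g z) (h z)) => gh.
  by rewrite ler0_norm ?subr_le0//; field.
by rewrite gtr0_norm ?subr_gt0//; field.
Qed.

Lemma trig_closure_min g h : trig_closure g -> trig_closure h ->
  trig_closure (fun z => Num.min (g z) (h z)).
Proof.
move=> cg ch; rewrite (_ : (fun z => _) =
  fun z => -1 * Num.max (-1 * g z) (-1 * h z)).
  by apply: trig_closureZ; apply: trig_closure_max; exact: trig_closureZ.
apply/funext => z; rewrite !mulN1r; case: (leP (g z) (h z)) => gh.
  by rewrite max_l ?opprK// lerN2.
by rewrite max_r ?opprK// lerN2 ltW.
Qed.

(** If x and y differ at s, the function cos(c (z s - y s)) with
    c = pi / (x s - y s) is -1 at x and 1 at y. The interpolation between al and
    be along it is a convex combination, so the bound M is not lost. *)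
Lemma trig_interpolation (x y : {uniform S -> R}) (al be M : R) :
  (x = y -> al = be) -> `|al| <= M -> `|be| <= M ->
  exists2 g, trig_poly g & [/\ g x = al, g y = be & forall z, `|g z| <= M].
Proof.
move=> xyab aM bM; have [xy|xy] := pselect (x = y).
  by exists (fun=> al); [exact: trig_cst|split=> //; rewrite xyab].
have [s xs] : exists s, x s != y s.
  apply: contrapT => /forallNP nxy; apply: xy; apply/funext => s.
  by apply: contrapT => /eqP; exact: nxy.
pose c := pi / (x s - y s).
exists (fun z => (be + al) / 2 + (be - al) / 2 * cos (linear_form [:: (c, s)] z - c * y s)).
  by apply: trig_add; [exact: trig_cst|apply: trig_scale; exact: trig_cos].
have lE (z : S -> R) : linear_form [:: (c, s)] z = c * z s.
  by rewrite /linear_form big_seq1.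
rewrite /= !lE; split.
- by rewrite -mulrBr /c divfK ?subr_eq0// cospi; field.
- by rewrite subrr cos0; field.
- move=> z; have := cos_le1 (linear_form [:: (c, s)] z - c * y s).
  have := cos_geN1 (linear_form [:: (c, s)] z - c * y s).
  move: (cos _) => q; rewrite !ler_norml in aM bM *.
  case/andP: aM => a1 a2; case/andP: bM => b1 b2 q1 q2; apply/andP; split; nra.
Qed.

End trigonometric_polynomials.

(** * Symmetry of centered Gaussian Radon laws *)

Section symmetry_of_gaussian_laws.
Context d (T : measurableType d) (R : realType) (P : probability T R).
Context (S : choiceType).
Implicit Types (V : S -> T -> R) (h g : {uniform S -> R} -> R).

Definition opp_path (z : {uniform S -> R}) : {uniform S -> R} := fun s => - z s.

Lemma sup_close_opp r (y z : {uniform S -> R}) : sup_close r y z ->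
  sup_close r (opp_path y) (opp_path z).
Proof. by move=> yz s; rewrite /opp_path -opprD normrN; exact: yz. Qed.

Lemma continuous_opp_path : continuous opp_path.
Proof.
move=> z A /nbhs_sup_closeP[e e0 eA]; apply/nbhs_sup_closeP; exists e => // y zy.
by apply: eA; exact: sup_close_opp.
Qed.

Lemma within_continuous_opp_path h : {within @linf R S, continuous h} ->
  {within @linf R S, continuous (h \o opp_path)}.
Proof.
move=> /continuous_linfP ch; apply/continuous_linfP => z lz e e0.
have lz' : linf (opp_path z).
  by case/linfP : lz => M zM; apply/linfP; exists M => s; rewrite normrN.
by have [r r0 hr] := ch _ lz' e e0; exists r => // y zy; apply: hr; exact: sup_close_opp.
Qed.

(** A generator involves V through a single real Gaussian variable. *)
Lemma trig_expectation_opp V g : centered_gaussian_process P V -> radon_law_linf P V ->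
  trig_poly g ->
  \int[P]_w g (V ^~ w) = \int[P]_w g (opp_path (V ^~ w)).
Proof.
move=> gV rV.
have int k : trig_poly k -> P.-integrable setT (EFin \o (fun w => k (V ^~ w))) /\
   P.-integrable setT (EFin \o (fun w => k (opp_path (V ^~ w)))).
  move=> tk; have [M M0 kM] := trig_bounded tk.
  have ck : {within @linf R S, continuous k}.
    by apply: continuous_subspaceT; exact: trig_continuous.
  split; apply: (bounded_integrable P (M := M)) => //.
    exact: measurable_comp_path rV ck.
  exact: measurable_comp_path rV (within_continuous_opp_path ck).
elim => [l theta|g1 g2 t1 IH1 t2 IH2|a g1 t1 IH].
- pose c (j : 'I_(size l)) := (tnth (in_tuple l) j).1.
  pose s (j : 'I_(size l)) := (tnth (in_tuple l) j).2.
  have lE z : linear_form l z = \sum_(j < size l) c j * z (s j).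
    by rewrite /linear_form (big_tnth _ _ l).
  under eq_Rintegral do rewrite lE.
  under [in RHS]eq_Rintegral => w _.
    rewrite (_ : linear_form l _ = - \sum_(j < size l) c j * V (s j) w).
      over.
    by rewrite lE -sumrN; apply: eq_bigr => j _; rewrite mulrN.
  apply: (gaussian_expectation_opp (phi := fun x => cos (x + theta)) (gV _ s c) (M := 1)).
    apply: continuous_measurable_fun => x.
    apply: (@continuous_comp _ _ _ (fun x => x + theta) cos).
      by apply: (@continuousD _ _ _ id (fun=> theta)); [exact: cvg_id|exact: cst_continuous].
    exact: continuous_cos.
  by move=> x; exact: cos_max.
- have [i1 j1] := int _ t1; have [i2 j2] := int _ t2.
  by rewrite !RintegralD// IH1 IH2.
- have [i1 j1] := int _ t1.
  by rewrite !RintegralZl// IH.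
Qed.

(** Let K carry the law of V up to e, and approximate h on the union of K and -K by
    a trigonometric polynomial p that is bounded independently of e. The
    expectations of p at V and at -V agree, and those of h differ from them by a
    multiple of e. *)
Lemma gaussian_law_opp V h : centered_gaussian_process P V -> radon_law_linf P V ->
  [bounded h z | z in setT] -> {within @linf R S, continuous h} ->
  ('E_P[(fun w => h (fun s => - V s w)%R)%R] = 'E_P[(fun w => h (V ^~ w))%R])%E.
Proof.
move=> gV rV bh ch.
have [M M0 hM] := bounded_by_gt0 bh.
have mh := measurable_comp_path rV ch.
have mho := measurable_comp_path rV (within_continuous_opp_path ch).
rewrite (expectationE (bounded_integrable P mh (fun w => hM (V ^~ w)))).
rewrite (expectationE (bounded_integrable P mho (fun w => hM (opp_path (V ^~ w))))).
congr EFin; apply/eqP; rewrite -subr_eq0 -normr_le0; apply/ler_addgt0Pr => e0 e00.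
rewrite add0r.
(* each of two comparisons costs 2 e + 2 (M + 1) e; e <= 1 bounds p by M + 1 *)
pose e := Num.min 1 (e0 / (8 + 4 * M)).
have e_gt0 : 0 < e by rewrite lt_min ltr01 divr_gt0//; lra.
have e_le1 : e <= 1 by rewrite ge_min lexx.
have ee0 : e * (8 + 4 * M) <= e0.
  by rewrite -ler_pdivlMr ?ge_min ?lexx ?orbT//; lra.
have [K [cK Kl mK PK]] := radon_compact rV e_gt0.
pose K' := K `|` opp_path @` K.
have cK' : compact K'.
  apply: compactU => //; apply: continuous_compact => //.
  by apply: continuous_subspaceT; exact: continuous_opp_path.
have K'l z : K' z -> linf z.
  case=> [/Kl//|[y /Kl ly <-]].
  by case/linfP : ly => N yN; apply/linfP; exists N => s; rewrite normrN.
(* off K' the approximants are controlled only by this bound *)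
pose L : set ({uniform S -> R} -> R) := [set g | trig_closure g /\ forall z, `|g z| <= M].
have [|g k [cg gM] [ck kM]|g k [cg gM] [ck kM]|x y Kx Ky|g x r [cg gM] Kx r0|g [cg gM] gh] :=
  @lattice_approximation _ R K' L h e cK' e_gt0.
- by exists (fun=> 0); split=> [|z]; [exact/trig_closure_poly/trig_cst|rewrite normr0 ltW].
- by split=> [|z]; [exact: trig_closure_max|case: (leP (g z) (k z))].
- by split=> [|z]; [exact: trig_closure_min|case: (leP (g z) (k z))].
- have [|g tg [gx gy gM]] := @trig_interpolation R S x y (h x) (h y) M _ (hM x) (hM y).
    by move=> ->.
  by exists g => //; split => //; exact: trig_closure_poly.
- apply/nbhs_sup_closeP.
  have r40 : 0 < r / 4 by rewrite divr_gt0.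
  have [p tp gp] := cg _ r40.
  have cp : {within @linf R S, continuous p}.
    by apply: continuous_subspaceT; exact: trig_continuous.
  have /continuous_linfP/(_ _ (K'l _ Kx) _ r40)[q q0 hq] := ch.
  have /continuous_linfP/(_ _ (K'l _ Kx) _ r40)[q' q'0 hq'] := cp.
  exists (Num.min q q'); first by rewrite lt_min q0.
  move=> y xy /=.
  have := hq y (sup_closeW _ xy); rewrite ge_min lexx => /(_ isT).
  have := hq' y (sup_closeW _ xy); rewrite ge_min lexx orbT => /(_ isT).
  have := gp x; have := gp y; rewrite !ler_norml; lra.
have [p tp gp] := cg _ e_gt0.
have cp : {within @linf R S, continuous p}.
  by apply: continuous_subspaceT; exact: trig_continuous.
have pM z : `|p z| <= M + 1.
  have := gp z; have := gM z; rewrite !ler_norml; lra.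
have hM1 z : `|h z| <= M + 1 by have := hM z; lra.
have hp z : K' z -> `|h z - p z| <= 2 * e.
  by move=> /gh; have := gp z; rewrite !ler_norml; lra.
have M10 : 0 <= M + 1 by lra.
have e20 : 0 <= 2 * e by lra.
have mp := measurable_comp_path rV cp.
have mpo := measurable_comp_path rV (within_continuous_opp_path cp).
have pV := Rintegral_close e20 M10 mh mp (fun w => hM1 _) (fun w => pM _) mK (ltW PK).
have pNV := Rintegral_close e20 M10 mho mpo (fun w => hM1 _) (fun w => pM _) mK (ltW PK).
have {}pV := pV (fun w nK => hp _ (or_introl (contrapT nK))).
have {}pNV := pNV (fun w nK => hp _ (or_intror (ex_intro2 _ _ _ (contrapT nK) erefl))).
rewrite /= -(trig_expectation_opp gV rV tp) in pNV.
move: pV pNV; rewrite !ler_norml.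
move: (Rintegral _ _ _) (Rintegral _ _ _) (Rintegral _ _ _) => i1 i2 i3.
move=> /andP[a1 a2] /andP[a3 a4]; apply/andP; split; lra.
Qed.

End symmetry_of_gaussian_laws.

(** * Uniform continuity of Radon processes *)

Section uniform_continuity.
Context d (T : measurableType d) (R : realType) (P : probability T R).

Lemma measurable_norm_gt (Y : T -> R) (e : R) : measurable_fun setT Y ->
  measurable [set w | e < `|Y w|].
Proof.
move=> mY.
rewrite (_ : [set w | _] = setT `&` (Num.norm \o Y) @^-1` `]e, +oo[); last first.
  by rewrite setTI; apply/seteqP; split=> w /=; rewrite in_itv/= andbT.
by apply: (measurableT_comp (@normr_measurable _ _) mY).
Qed.

Lemma radon_law_measurable (S : choiceType) (V : S -> T -> R) s :
  radon_law_linf P V -> measurable_fun setT (V s).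
Proof.
move=> rV; apply: (measurable_comp_path (h := fun z => z s) rV).
apply: (lipschitz_continuous_linf (C := 1)) => // e y z _ /(_ s).
by rewrite ler_norml mul1r; lra.
Qed.

Lemma markov_sqr (Y : T -> R) (e p : R) : measurable_fun setT Y -> 0 < e ->
  ('E_P[(fun w => Y w ^+ 2)%R] <= (e ^+ 2 * p)%:E)%E ->
  (P [set w | (e < `|Y w|)%R] <= p%:E)%E.
Proof.
move=> mY e0 EY; have mA := measurable_norm_gt e mY.
have e20 : 0 < e ^+ 2 by rewrite exprn_gt0.
rewrite -(@lee_pmul2l _ (e ^+ 2)%:E)// -EFinM; apply: le_trans EY.
rewrite -(expectation_indic P mA).
have i1 : P.-integrable setT (EFin \o (\1_[set w | e < `|Y w|] : T -> R)).
  apply: (@bounded_integrable _ _ _ _ _ 1) => [|w]; first exact: measurable_indic.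
  by rewrite indicE; case: (w \in _) => /=; rewrite ?normr1 ?normr0.
rewrite -expectationZl; last exact/Lfun1_integrable.
apply: expectation_le => //.
- exact: measurable_funM.
- exact: measurable_funX.
- by move=> w; rewrite /= mulr_ge0 // ltW.
- by move=> w; rewrite sqr_ge0.
- apply/aeW => w /=; rewrite indicE; have [wA|nA] := pselect (e < `|Y w|).
    rewrite mem_set// mul1r -(real_normK (num_real (Y w))).
    by rewrite lerXn2r ?nnegrE// ltW.
  by rewrite memNset// mul0r sqr_ge0.
Qed.

(** Up to an event of small probability, the paths are bounded by a common
    constant and share a modulus of uniform continuity for the L2-distance of the
    process. By compact_ideal it suffices to treat a small ball U around a path x.
    If U is not charged, it is put into the exceptional event. If it has
    probability greater than p > 0, and s, s' are so close that an increment
    exceeding e / 5 has probability at most p, then some path in U has a small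
    increment, and so have x and all the other paths in U. *)
Lemma radon_law_uniformly_continuous (S : choiceType) (V : S -> T -> R) (e c : R) :
  radon_law_linf P V -> 0 < e -> 0 < c ->
  exists (M rho : R) (N : set T), [/\ 0 < rho, measurable N, (P N < c%:E)%E &
    forall w, ~ N w -> (forall s, `|V s w| <= M) /\
      forall s s', ('E_P[(fun w' => (V s w' - V s' w') ^+ 2)%R] <= rho%:E)%E ->
        `|V s w - V s' w| <= e].
Proof.
move=> rV e0 c0.
have [K [cK Kl mK PK]] := radon_compact rV c0.
pose good (M rho : R) w := (forall s, `|V s w| <= M) /\
  forall s s', ('E_P[(fun w' => (V s w' - V s' w') ^+ 2)%R] <= rho%:E)%E ->
    `|V s w - V s' w| <= e.
have goodW (M M' rho rho' : R) w : M <= M' -> rho' <= rho -> good M rho w -> good M' rho' w.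
  move=> MM rr [gM ge]; split=> [s|s s' ss]; first exact: le_trans MM.
  by apply: ge; apply: le_trans ss _; rewrite lee_fin.
pose I (A : set {uniform S -> R}) := exists (M rho : R) (N : set T),
  [/\ 0 < rho, measurable N, P N = 0%E &
      forall w, ~ N w -> A (V ^~ w) -> good M rho w].
have [|A B BA|A B|x Kx|] := @compact_ideal _ K I cK.
- by exists 0, 1, set0; split => //; rewrite measure0.
- move=> [M [rho [N [r0 mN PN NA]]]]; exists M, rho, N; split => // w Nw /BA.
  exact: NA.
- move=> [M [rho [N [r0 mN PN NA]]]] [M' [rho' [N' [r'0 mN' PN' NB]]]].
  exists (Num.max M M'), (Num.min rho rho'), (N `|` N'); split.
  + by rewrite lt_min r0.
  + exact: measurableU.
  + by rewrite measureU0.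
  + move=> w nN [Aw|Bw].
      apply: (@goodW M _ rho); rewrite ?le_max ?ge_min ?lexx ?orbT//.
      by apply: NA => // ?; apply: nN; left.
    apply: (@goodW M' _ rho'); rewrite ?le_max ?ge_min ?lexx ?orbT//.
    by apply: NB => // ?; apply: nN; right.
- have q0 : 0 < e / 5 by rewrite divr_gt0.
  pose U := [set z : {uniform S -> R} | sup_close (e / 5) x z]°.
  have mU : measurable [set w | U (V ^~ w)].
    by apply: (path_measurable_preimage rV); exact: open_interior.
  exists U.
    by apply: nbhs_interior; apply/nbhs_sup_closeP; exists (e / 5).
  have [PU|PU] := eqVneq (P [set w | U (V ^~ w)]) 0%E.
    by exists 0, 1, [set w | U (V ^~ w)]; split.
  have [p p0 pU] : exists2 p : R, 0 < p & (p%:E < P [set w | U (V ^~ w)])%E.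
    have pfin : P [set w | U (V ^~ w)] \is a fin_num by exact: fin_num_measure.
    exists (fine (P [set w | U (V ^~ w)]) / 2).
      by rewrite divr_gt0// fine_gt0// lt0e PU measure_ge0 ltey_eq pfin.
    rewrite -{2}(fineK pfin) lte_fin ltr_pdivrMr// mulr_natr mulr2n ltrDr.
    by rewrite fine_gt0// lt0e PU measure_ge0 ltey_eq pfin.
  have /linfP[M xM] := Kl _ Kx.
  have xV w s : U (V ^~ w) -> `|x s - V s w| <= e / 5.
    by move=> /interior_subset; apply.
  (* this value of rho makes Markov's inequality give the probability p *)
  exists (M + e), ((e / 5) ^+ 2 * p), set0; split => //.
    by rewrite mulr_gt0// exprn_gt0.
  move=> w _ Uw; split=> [s|s s' ss].
    have := ler_normB (x s) (x s - V s w); rewrite subKr.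
    by have := xV w s Uw; have := xM s; lra.
  have mVs : measurable_fun setT (fun w' => V s w' - V s' w').
    by apply: measurable_funB; exact: radon_law_measurable.
  have [w' [Uw' w'e]] : exists w', U (V ^~ w') /\ `|V s w' - V s' w'| <= e / 5.
    apply: contrapT => nw'; have := markov_sqr mVs q0 ss.
    apply/negP; rewrite -ltNge; apply: lt_le_trans pU _.
    apply: le_measure; rewrite ?inE//.
      exact: measurable_norm_gt.
    move=> w' Uw' /=; rewrite ltNge; apply/negP => ?; apply: nw'; by exists w'.
  have := xV _ s Uw; have := xV _ s' Uw; have := xV _ s Uw'; have := xV _ s' Uw'.
  move: w'e; rewrite !ler_norml; lra.
- move=> M [rho [N [r0 mN PN NA]]].
  exists M, rho, ([set w | ~ K (V ^~ w)] `|` N); split => //.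
  + exact: measurableU.
  + by rewrite measureU0.
  + move=> w nN; apply: NA => [?|]; first by apply: nN; right.
    by apply: contrapT => ?; apply: nN; left.
Qed.

End uniform_continuity.

(** * Distribution functions and densities *)

Section distribution_function.
Context d0 d (T0 : measurableType d0) (T : measurableType d) (R : realType).
Context (P0 : probability T0 R) (P : probability T R) (E : choiceType).
Context (X : E -> {RV P0 >-> R}) (Xs : nat -> E -> {RV P >-> R}) (G : E * R -> T -> R).

Lemma dist_funE t x : (dist_fun X t x)%:E = cdf (X t) x.
Proof. by rewrite /dist_fun fineK// fin_num_measure. Qed.

Lemma dist_fun_nondecreasing t x y : x <= y -> dist_fun X t x <= dist_fun X t y.
Proof. by move=> xy; rewrite -lee_fin !dist_funE; exact: cdf_nondecreasing. Qed.

Lemma dist_fun_ex_gt t (a : R) : a < 1 -> exists x, a <= dist_fun X t x.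
Proof.
move=> a1; have n1 : nbhs 1%E [set y : \bar R | (a%:E < y)%E].
  by apply: open_ereal_gt'; rewrite lte_fin.
have [M [_ hM]] := cvg_cdfy1 (X t) n1; exists (M + 1).
have /hM : M < M + 1 by rewrite ltrDl.
by rewrite /preimage /= -dist_funE lte_fin => /ltW.
Qed.

Lemma dist_fun_ex_lt t (a : R) : 0 < a -> exists x, dist_fun X t x < a.
Proof.
move=> a0; have n0 : nbhs 0%E [set y : \bar R | (y < a%:E)%E].
  by apply: open_ereal_lt'; rewrite lte_fin.
have [M [_ hM]] := cvg_cdfNy0 (X t) n0; exists (M - 1).
have /hM : M - 1 < M by rewrite ltrBlDr ltrDl.
by rewrite /preimage /= -dist_funE lte_fin.
Qed.

(** With q = |F(t, x) - F(t, y)|, the covariance gives exactly q - q^2. *)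
Lemma limit_process_increment t x y : empirical_clt X Xs G ->
  ('E_P[(fun w => (G (t, x) w - G (t, y) w) ^+ 2)%R] <=
   `|dist_fun X t x - dist_fun X t y|%:E)%E.
Proof.
move=> [cov [_ rG _]].
have mG s : measurable_fun setT (G s) by exact: radon_law_measurable rG.
have covE u v : ('E_P[(fun w => G (t, u) w * G (t, v) w)%R] =
    (dist_fun X t (Num.min u v) - dist_fun X t u * dist_fun X t v)%:E)%E.
  rewrite cov EFinB dist_funE; congr (_ - _)%E; rewrite /cdf /distribution /pushforward.
  by congr (P0 _); apply/seteqP; split=> w /=; rewrite in_itv/= le_min => /andP.
have i2 u : P.-integrable setT (EFin \o (fun w => G (t, u) w * G (t, u) w)).
  apply/integrableP; split.
    by apply/measurable_EFinP; exact: measurable_funM.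
  have := covE u u; rewrite unlock => EG.
  under eq_integral => w _.
    rewrite /= ger0_norm; last by rewrite -expr2 sqr_ge0.
    over.
  by rewrite EG ltry.
have ixy : P.-integrable setT (EFin \o (fun w => G (t, x) w * G (t, y) w)).
  apply: (@le_integrable _ _ _ P _ measurableT _
    (EFin \o (fun w => G (t, x) w * G (t, x) w + G (t, y) w * G (t, y) w))).
  - by apply/measurable_EFinP; exact: measurable_funM.
  - move=> w _ /=; rewrite lee_fin (ger0_norm (addr_ge0 _ _)) -?expr2 ?sqr_ge0//.
    have := sqr_ge0 (G (t, x) w - G (t, y) w); have := sqr_ge0 (G (t, x) w + G (t, y) w).
    rewrite ler_norml; move: (G (t, x) w) (G (t, y) w) => p q.
    by rewrite !expr2 => h1 h2; apply/andP; split; nra.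
  - by have := integrableD measurableT (i2 x) (i2 y).
have eE : ('E_P[(fun w => (G (t, x) w - G (t, y) w) ^+ 2)%R] =
   'E_P[(fun w => G (t, x) w * G (t, x) w)%R] - 2%:E * 'E_P[(fun w => G (t, x) w * G (t, y) w)%R]
    + 'E_P[(fun w => G (t, y) w * G (t, y) w)%R])%E.
  rewrite (expectationE (i2 x)) (expectationE (i2 y)) (expectationE ixy).
  rewrite -EFinM -EFinB -EFinD -RintegralZl// -RintegralB//; last first.
    by have := integrableZl measurableT 2 ixy.
  rewrite -RintegralD//; last first.
    by have := integrableB measurableT (i2 x) (integrableZl measurableT 2 ixy).
  rewrite -expectationE//.
    by rewrite unlock; apply: eq_integral => w _ /=; congr EFin; ring.
  have := integrableD measurableT (integrableB measurableT (i2 x)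
    (integrableZl measurableT 2 ixy)) (i2 y).
  by [].
rewrite eE !covE -EFinM -EFinB -EFinD lee_fin !minxx.
have [xy|yx] := leP x y.
  have := dist_fun_nondecreasing t xy; move: (dist_fun X t x) (dist_fun X t y) => p q pq.
  rewrite ler0_norm ?subr_le0//; nra.
have := dist_fun_nondecreasing t (ltW yx); move: (dist_fun X t x) (dist_fun X t y) => p q pq.
rewrite ger0_norm ?subr_ge0//; nra.
Qed.

End distribution_function.

Section density.
Variable R : realType.
Implicit Types (F f : R -> R).

(** Non-strict inequalities, to be used with linear arithmetic. *)
Definition eps_continuous F := forall x eta, 0 < eta ->
  exists2 s, 0 < s & forall y, `|y - x| <= s -> `|F y - F x| <= eta.

Lemma density_increment F f (x y lo hi : R) : has_density F f -> x <= y ->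
  (forall u, x <= u <= y -> lo <= f u <= hi) ->
  lo * (y - x) <= F y - F x <= hi * (y - x).
Proof.
move=> [mf f0 FE] xy flh.
have mfE : measurable_fun setT (EFin \o f) by exact/measurable_EFinP.
have mfA (A : set R) : measurable_fun A (EFin \o f) by exact: measurable_funS mfE.
have Fxy : ((F y)%:E = (F x)%:E + \int[@lebesgue_measure R]_(u in `]x, y]) (f u)%:E)%E.
  rewrite !FE -ge0_integral_setU//=.
  - by rewrite -itv_bndbnd_setU//= ?bnd_simp.
  - exact: mfA.
  - by move=> u hu; rewrite lee_fin.
  - rewrite disj_set2E; apply/eqP/seteqP; split => // u /= []; rewrite !in_itv/= => ux /andP[xu _].
    by move: (lt_le_trans xu ux); rewrite ltxx.
have cstE (r : R) : (\int[@lebesgue_measure R]_(u in `]x, y]) r%:E = (r * (y - x))%:E)%E.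
  rewrite integral_cst//= lebesgue_measure_itv/= lte_fin; case: ltP => // yx.
  by rewrite (_ : y = x) ?subrr ?mulr0 ?mule0//; apply/eqP; rewrite eq_le xy yx.
have FB : (\int[@lebesgue_measure R]_(u in `]x, y]) (f u)%:E = (F y - F x)%:E)%E.
  move: Fxy; move: (\int[_]_(u in _) _)%E => I; case: I => // r.
  by rewrite -EFinD => -[Fr]; congr EFin; rewrite Fr addrAC subrr add0r.
apply/andP; split; last first.
  rewrite -lee_fin -cstE -FB; apply: ge0_le_integral => //.
  - by move=> u _; rewrite lee_fin.
  - exact: mfA.
  - move=> u /=; rewrite in_itv/= => /andP[xu uy]; rewrite lee_fin.
    by have /andP[] : lo <= f u <= hi by apply: flh; rewrite (ltW xu).
(* for lo < 0 the monotonicity of F is stronger *)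
have [lo0|lo0] := leP 0 lo.
  rewrite -lee_fin -cstE -FB; apply: ge0_le_integral => //.
    exact: mfA.
  move=> u /=; rewrite in_itv/= => /andP[xu uy]; rewrite lee_fin.
  by have /andP[] : lo <= f u <= hi by apply: flh; rewrite (ltW xu).
apply: (@le_trans _ _ 0); first by rewrite mulr_le0_ge0 ?subr_ge0// ltW.
by rewrite -lee_fin -FB integral_ge0// => u _; rewrite lee_fin.
Qed.

(** Near x the density is at most f x + 1, so F is locally Lipschitz. *)
Lemma density_continuous F f (delta : R) : has_density F f -> 0 < delta ->
  (forall u v, `|u - v| <= delta -> `|f u - f v| <= 1) ->
  eps_continuous F.
Proof.
move=> Ff d0 fu x eta eta0; have f0 : 0 <= f x by case: Ff.
have f1 : 0 < f x + 1 by lra.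
exists (Num.min delta (eta / (f x + 1))); first by rewrite lt_min d0 divr_gt0.
move=> y; rewrite le_min => /andP[yd ye].
have fb u : `|u - x| <= `|y - x| -> 0 <= f u <= f x + 1.
  move=> ux; have := fu u x (le_trans ux yd); rewrite ler_norml => /andP[_ ?].
  by apply/andP; split; [case: Ff|lra].
move: ye; rewrite ler_pdivlMr// => ye.
have [xy|yx] := leP x y.
  have /andP[] : 0 * (y - x) <= F y - F x <= (f x + 1) * (y - x).
    apply: (density_increment Ff xy) => u /andP[xu uy].
    by apply: fb; rewrite !ger0_norm; lra.
  move: ye; rewrite ger0_norm ?subr_ge0// => ye h1 h2.
  by rewrite ger0_norm; lra.
have /andP[] : 0 * (x - y) <= F x - F y <= (f x + 1) * (x - y).
  apply: (density_increment Ff (ltW yx)) => u /andP[xu uy].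
  by apply: fb; rewrite !ler0_norm; lra.
move: ye; rewrite distrC ger0_norm ?subr_ge0 ?(ltW yx)// => ye h1 h2.
by rewrite distrC ger0_norm; lra.
Qed.

End density.

(** * Linearization of quantiles *)

Section quantiles.
Variable R : realType.
Implicit Types (H F Fn f : R -> R).

Lemma below_quantile H (alpha lb y : R) : {homo H : x y / x <= y} -> H lb < alpha ->
  y < quantile H alpha -> H y < alpha.
Proof.
move=> Hnd Hlb yq; rewrite ltNge; apply/negP => ay.
move: yq; rewrite ltNge => /negP; apply; apply: ge_inf => //.
exists lb => x /= ax; rewrite leNgt; apply/negP => /ltW /Hnd xlb.
by move: (lt_le_trans Hlb (le_trans ax xlb)); rewrite ltxx.
Qed.

Lemma above_quantile H (alpha ub y : R) : {homo H : x y / x <= y} -> alpha <= H ub ->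
  quantile H alpha < y -> alpha <= H y.
Proof.
move=> Hnd Hub /inf_lt[|x /= ax /ltW/Hnd]; first by exists ub.
exact: le_trans.
Qed.

Lemma quantile_itv H (alpha lb ub : R) : {homo H : x y / x <= y} ->
  H lb < alpha -> alpha <= H ub -> lb <= quantile H alpha <= ub.
Proof.
move=> Hnd Hlb Hub; apply/andP; split; rewrite leNgt; apply/negP => q.
  by have := above_quantile Hnd Hub q; rewrite leNgt Hlb.
by have := below_quantile Hnd Hlb q; rewrite ltNge Hub.
Qed.

Lemma quantileK F (alpha lb ub : R) : {homo F : x y / x <= y} -> eps_continuous F ->
  F lb < alpha -> alpha <= F ub -> F (quantile F alpha) = alpha.
Proof.
move=> Fnd cF Flb Fub; set q := quantile F alpha.
apply/eqP; rewrite eq_le; apply/andP; split; apply/ler_addgt0Pr => eta eta0;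
  have [s s0 hs] := cF q eta eta0.
- have : F (q - s) < alpha by apply: (below_quantile Fnd Flb); rewrite -/q; lra.
  have /hs : `|q - s - q| <= s by rewrite ler_norml; lra.
  by rewrite ler_norml; lra.
- have : alpha <= F (q + s) by apply: (above_quantile Fnd Fub); rewrite -/q; lra.
  have /hs : `|q + s - q| <= s by rewrite ler_norml; lra.
  by rewrite ler_norml; lra.
Qed.

(** Here k is sqrt n, q the quantile of Fn, and nu x = k (Fn x - F x). The bound M
    on nu and the lower bound kappa on the slope of F place q within
    r = (M + 1) / (kappa k) of tau. Just below q one has Fn < alpha and just above
    it Fn >= alpha, that is, k (F - alpha) < - nu, respectively >= - nu. As F is
    continuous and nu oscillates by at most c between such points and tau, it
    follows that k (F q - alpha) is within c of - nu tau. Finally F q - F tau is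
    (q - tau) f tau up to r eps. The points used are near q and not q itself, because Fn
    may jump at q. *)
Lemma quantile_linearization F Fn f (alpha tau k kappa theta delta rho c M eps : R) :
  has_density F f -> eps_continuous F -> {homo Fn : x y / x <= y} ->
  F tau = alpha -> 0 < k -> 0 < kappa -> 0 <= M ->
  (forall x, `|x - tau| <= theta -> kappa <= f x) ->
  (forall x, `|x - tau| <= delta -> `|f x - f tau| <= eps) ->
  (M + 1) / kappa / k <= Num.min theta delta -> M / k < rho ->
  (forall x, `|k * (Fn x - F x)| <= M) ->
  (forall x y, `|F x - F y| <= rho ->
     `|k * (Fn x - F x) - k * (Fn y - F y)| <= c) ->
  `|k * (quantile Fn alpha - tau) * f tau + k * (Fn tau - F tau)| <=
     c + (M + 1) / kappa * eps.
Proof.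
move=> Ff cF Fnnd Ftau k0 kappa0 M0 flow fmod rmin Mrho numax nuosc.
set r := (M + 1) / kappa / k in rmin.
have r0 : 0 < r by rewrite !divr_gt0//; lra.
have rk : kappa * r * k = M + 1 by rewrite /r; field; rewrite !gt_eqF.
move: rmin; rewrite le_min => /andP[rtheta rdelta].
have fb u : `|u - tau| <= r -> kappa <= f u <= f tau + eps.
  move=> ur; apply/andP; split; first by apply: flow; exact: le_trans rtheta.
  by have := fmod u (le_trans ur rdelta); rewrite ler_norml => /andP[_]; lra.
have Fup : alpha + kappa * r <= F (tau + r).
  have /andP[] : kappa * (tau + r - tau) <= F (tau + r) - F tau
      <= (f tau + eps) * (tau + r - tau).
    apply: (density_increment Ff) => [|u /andP[u1 u2]]; first lra.
    by apply: fb; rewrite ger0_norm; lra.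
  by rewrite addrAC subrr add0r Ftau; lra.
have Flo : F (tau - r) <= alpha - kappa * r.
  have /andP[] : kappa * (tau - (tau - r)) <= F tau - F (tau - r)
      <= (f tau + eps) * (tau - (tau - r)).
    apply: (density_increment Ff) => [|u /andP[u1 u2]]; first lra.
    by apply: fb; rewrite ler0_norm; lra.
  by rewrite subKr Ftau; lra.
have kF x : k * (Fn x - F x) = k * Fn x - k * F x by ring.
have kpos u v : k * u <= k * v -> u <= v by rewrite ler_pM2l.
have Hub : alpha <= Fn (tau + r).
  apply: kpos; have := numax (tau + r); rewrite ler_norml kF => /andP[h _].
  have := ler_wpM2l (ltW k0) Fup; nra.
have Hlb : Fn (tau - r) < alpha.
  rewrite -(ltr_pM2l k0); have := numax (tau - r); rewrite ler_norml kF => /andP[_ h].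
  have := ler_wpM2l (ltW k0) Flo; nra.
set q := quantile Fn alpha.
have /andP[ql qu] := quantile_itv Fnnd Hlb Hub; rewrite -/q in ql qu.
have below y : y < q -> Fn y < alpha by exact: below_quantile Fnnd Hlb.
have above y : q < y -> alpha <= Fn y by exact: above_quantile Fnnd Hub.
have Fql : alpha - M / k <= F q.
  apply/ler_addgt0Pr => eta eta0; have [s s0 hs] := cF q eta eta0.
  have := above (q + s); rewrite ltrDl => /(_ s0) h.
  have /hs : `|q + s - q| <= s by rewrite ler_norml; lra.
  rewrite ler_norml => /andP[_ h2].
  have := numax (q + s); rewrite ler_norml => /andP[_ h3].
  have h4 : Fn (q + s) - F (q + s) <= M / k by rewrite ler_pdivlMr// mulrC.
  lra.
have Fqu : F q <= alpha + M / k.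
  apply/ler_addgt0Pr => eta eta0; have [s s0 hs] := cF q eta eta0.
  have := below (q - s); rewrite ltrBlDr ltrDl => /(_ s0) h.
  have /hs : `|q - s - q| <= s by rewrite ler_norml; lra.
  rewrite ler_norml => /andP[h2 _].
  have := numax (q - s); rewrite ler_norml => /andP[h3 _].
  have h4 : - (M / k) <= Fn (q - s) - F (q - s).
    by rewrite -mulNr ler_pdivrMr// mulrC.
  lra.
pose nu := k * (Fn tau - F tau).
have main : `|k * (F q - alpha) + nu| <= c.
  rewrite ler_norml; apply/andP; split; apply/ler_addgt0Pr => eta eta0.
  (* rho - M / k is what remains of rho for moving away from q *)
  - have e0 : 0 < Num.min (eta / k) (rho - M / k).
      by rewrite lt_min divr_gt0//=; lra.
    have [s s0 hs] := cF q _ e0.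
    have := above (q + s); rewrite ltrDl => /(_ s0) h.
    have /hs : `|q + s - q| <= s by rewrite ler_norml; lra.
    rewrite le_min => /andP[]; rewrite ler_pdivlMr// => h1 h2.
    have : `|F (q + s) - F tau| <= rho.
      by rewrite Ftau; move: h2; rewrite !ler_norml; lra.
    move=> /nuosc; rewrite -/nu ler_norml => /andP[_ h3].
    have h4 : k * alpha <= k * Fn (q + s) by rewrite ler_pM2l.
    have h5 : k * F (q + s) - k * F q <= eta.
      rewrite -mulrBr mulrC; apply: le_trans h1; rewrite ler_pM2r//; exact: ler_norm.
    rewrite !kF in h3 *; lra.
  - have e0 : 0 < Num.min (eta / k) (rho - M / k).
      by rewrite lt_min divr_gt0//=; lra.
    have [s s0 hs] := cF q _ e0.
    have := below (q - s); rewrite ltrBlDr ltrDl => /(_ s0) h.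
    have /hs : `|q - s - q| <= s by rewrite ler_norml; lra.
    rewrite le_min => /andP[]; rewrite ler_pdivlMr// => h1 h2.
    have : `|F (q - s) - F tau| <= rho.
      by rewrite Ftau; move: h2; rewrite !ler_norml; lra.
    move=> /nuosc; rewrite -/nu ler_norml => /andP[h3 _].
    have h4 : k * Fn (q - s) <= k * alpha by rewrite ler_pM2l// ltW.
    have h5 : k * F q - k * F (q - s) <= eta.
      rewrite -mulrBr mulrC; apply: le_trans h1; rewrite ler_pM2r// distrC; exact: ler_norm.
    rewrite !kF in h3 *; lra.
have eps0 : 0 <= eps by apply: le_trans (fmod tau _) => //; rewrite subrr normr0; lra.
have taylor : `|(F q - alpha) - (q - tau) * f tau| <= r * eps.
  have fb2 u : `|u - tau| <= r -> f tau - eps <= f u <= f tau + eps.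
    by move=> ur; have := fmod u (le_trans ur rdelta); rewrite ler_norml; lra.
  have [tq|/ltW qt] := leP tau q.
    have /andP[] : (f tau - eps) * (q - tau) <= F q - F tau <= (f tau + eps) * (q - tau).
      apply: (density_increment Ff tq) => u /andP[u1 u2].
      by apply: fb2; rewrite ger0_norm; lra.
    rewrite Ftau => h1 h2; have : (q - tau) * eps <= r * eps by rewrite ler_wpM2r//; lra.
    by rewrite ler_norml => h3; apply/andP; split; lra.
  have /andP[] : (f tau - eps) * (tau - q) <= F tau - F q <= (f tau + eps) * (tau - q).
    apply: (density_increment Ff qt) => u /andP[u1 u2].
    by apply: fb2; rewrite ler0_norm; lra.
  rewrite Ftau => h1 h2; have : (tau - q) * eps <= r * eps by rewrite ler_wpM2r//; lra.
  by rewrite ler_norml => h3; apply/andP; split; lra.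
have -> : k * (q - tau) * f tau + k * (Fn tau - F tau) =
  (k * (F q - alpha) + nu) - k * ((F q - alpha) - (q - tau) * f tau).
  by rewrite /nu; ring.
apply: le_trans (ler_normB _ _) _; apply: lerD => //.
rewrite normrM gtr0_norm//.
have -> : (M + 1) / kappa * eps = k * (r * eps) by rewrite /r; field; rewrite !gt_eqF.
by rewrite ler_pM2l.
Qed.

End quantiles.

(** * The central limit theorem for quantile processes *)

Section quantile_clt.
Context d0 d (T0 : measurableType d0) (T : measurableType d) (R : realType).
Context (P0 : probability T0 R) (P : probability T R) (E : choiceType).
Context (X : E -> {RV P0 >-> R}) (Xs : nat -> E -> {RV P >-> R}).

Lemma emp_dist_fun_nondecreasing n t w :
  {homo (fun x => emp_dist_fun Xs n t x w) : x y / x <= y}.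
Proof.
move=> x y xy; rewrite /emp_dist_fun ler_wpM2l ?invr_ge0//; apply: ler_sum => i _.
rewrite !indicE ler_nat; have [Xx|Xx] := pselect (Xs i t w <= x).
  by rewrite !mem_set//= in_itv//=; exact: le_trans Xx xy.
by rewrite memNset//= in_itv.
Qed.

Lemma sup_modulus_unif (f : E -> R -> R) (eps : R) :
  sup_modulus f delta @[delta --> 0^'+] --> 0%E -> 0 < eps ->
  exists2 delta, 0 < delta & forall t u v, `|u - v| <= delta -> `|f t u - f t v| <= eps.
Proof.
move=> f0 e0; have ne : nbhs (0%E : \bar R) [set y : \bar R | (y < eps%:E)%E].
  by apply: open_ereal_lt'; rewrite lte_fin.
have h1 : \forall delta \near 0^'+, (sup_modulus f delta < eps%:E)%E by exact: f0 ne.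
have h2 : \forall delta \near (0 : R)^'+, 0 < delta by exact: nbhs_right_gt.
have [delta [d1 d2]] := @filter_ex _ _ (at_right_proper_filter (0 : R)) _ (filterI h1 h2).
exists delta => // t u v uv; rewrite -lee_fin; apply: le_trans (ltW d1).
by apply: ereal_sup_ubound; exists t, u, v.
Qed.

Lemma sqrt_nat_unbounded (B : R) : \forall n \near \oo, B <= Num.sqrt n%:R.
Proof.
have := nbhs_infty_ger (B ^+ 2); apply: filterS => n Bn.
by rewrite (le_trans (ler_norm B))// -sqrtr_sqr ler_wsqrtr.
Qed.

Variables (G : E * R -> T -> R) (f : E -> R -> R) (a b kappa theta : R).
Hypothesis X_clt : empirical_clt X Xs G.
Hypothesis F_density : forall t, has_density (dist_fun X t) (f t).
Hypothesis f_unif : sup_modulus f delta @[delta --> 0^'+] --> 0%E.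
Hypotheses (ha : 0 < a) (hb : b < 1) (kappa0 : 0 < kappa) (theta0 : 0 < theta).
Local Notation tau t alpha := (quantile (dist_fun X t) alpha).
Hypothesis f_low : forall t alpha x, a <= alpha <= b -> `|x - tau t alpha| <= theta ->
  kappa <= f t x.
Local Notation I := (set_type `[a, b]%classic).

Lemma set_type_itvP (alpha : I) : a <= val alpha <= b.
Proof. by have := set_valP alpha; rewrite /= in_itv. Qed.

(** The good event is that nu_n is within r / 8 of a function that is bounded by M
    and oscillates by at most r / 4. Then nu_n oscillates by at most r / 2, and the
    choice of eps makes the other error of quantile_linearization r / 2 as well. *)
Lemma quantile_process_linearization (r c : R) : 0 < r -> 0 < c ->
  \forall n \near \oo, (upper_expectation P
    (\1_[set w | ~ sup_close r
       (fun s : E * I => quantile_process X Xs n s.1 (val s.2) w * f s.1 (tau s.1 (val s.2)))%R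
       (fun s : E * I => -1 * emp_process X Xs n (s.1, tau s.1 (val s.2)) w)%R]) < c%:E)%E.
Proof.
move=> r0 c0; have [_ cG] := X_clt; have [_ rG _] := cG.
have e10 : 0 < r / 4 by rewrite divr_gt0.
have e20 : 0 < r / 8 by rewrite divr_gt0.
have [M [rho [N [rho0 mN PN good]]]] := radon_law_uniformly_continuous rG e10 c0.
pose A := [set z : {uniform E * R -> R} | (forall s, `|z s| <= M) /\
  forall t x y, `|dist_fun X t x - dist_fun X t y| <= rho -> `|z (t, x) - z (t, y)| <= r / 4].
have NA w : ~ N w -> A (G ^~ w).
  move=> /good[GM Ge]; split=> // t x y xy; apply: Ge.
  by apply: le_trans (limit_process_increment t x y X_clt) _; rewrite lee_fin.
have outer := clt_outer_near cG mN PN NA e20.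
pose M' := `|M| + r / 8.
have M'0 : 0 <= M' by rewrite addr_ge0// ltW.
pose eps := r * kappa / (2 * (M' + 1)).
have M'1 : 0 < M' + 1 by lra.
have eps0 : 0 < eps by rewrite !divr_gt0 ?mulr_gt0.
have [delta delta0 fdelta] := sup_modulus_unif f_unif eps0.
have [delta1 delta10 fdelta1] := sup_modulus_unif f_unif (@ltr01 R).
have mu0 : 0 < Num.min theta delta by rewrite lt_min theta0.
have big1 := sqrt_nat_unbounded ((M' + 1) / kappa / Num.min theta delta).
have big2 := sqrt_nat_unbounded (M' / rho + 1).
near=> n.
have n1 : (M' + 1) / kappa / Num.min theta delta <= Num.sqrt n%:R by near: n; exact: big1.
have n2 : M' / rho + 1 <= Num.sqrt n%:R by near: n; exact: big2.
have k0 : 0 < Num.sqrt n%:R :> R.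
  by apply: lt_le_trans n1; rewrite !divr_gt0.
apply: (@le_lt_trans _ _ (upper_expectation P
  \1_[set w | ~ exists2 y, A y & sup_close (r / 8) (emp_process X Xs n ^~ w) y])); last first.
  by near: n; exact: outer.
apply: upper_expectation_mono => w; rewrite !indicE ler_nat.
case: (boolP (w \in [set w | ~ sup_close _ _ _])) => //=; rewrite inE/= => nW.
rewrite mem_set//=; apply: contra_not nW => -[z [zM zosc] nuz] [t i].
change (`|quantile_process X Xs n t (val i) w * f t (tau t (val i)) -
  -1 * emp_process X Xs n (t, tau t (val i)) w| <= r).
rewrite mulN1r opprK /quantile_process.
have nuE x : emp_process X Xs n (t, x) w =
  Num.sqrt n%:R * (emp_dist_fun Xs n t x w - dist_fun X t x) by [].
have := set_type_itvP i; move: (val i) => alpha aab.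
have /andP[alpha_a alpha_b] := aab.
have [ub hub] := dist_fun_ex_gt X t (le_lt_trans alpha_b hb).
have [lb hlb] := dist_fun_ex_lt X t (lt_le_trans ha alpha_a).
have cF : eps_continuous (dist_fun X t).
  exact: density_continuous (F_density t) delta10 (fdelta1 t).
have Ftau : dist_fun X t (tau t alpha) = alpha.
  apply: quantileK cF hlb hub; exact: dist_fun_nondecreasing.
rewrite nuE.
have -> : r = r / 2 + (M' + 1) / kappa * eps.
  by rewrite /eps; field; rewrite !gt_eqF//; lra.
apply: (quantile_linearization (F := dist_fun X t)
  (Fn := fun x => emp_dist_fun Xs n t x w) (theta := theta) (delta := delta) (rho := rho)
  (F_density t) cF _ Ftau k0 kappa0 M'0).
- exact: emp_dist_fun_nondecreasing.
- by move=> x; exact: f_low.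
- by move=> x; exact: fdelta.
- by move: n1; rewrite ler_pdivrMr// (mulrC (Num.sqrt _)) -ler_pdivrMr.
- by rewrite ltr_pdivrMr// (mulrC rho) -ltr_pdivrMr//; apply: lt_le_trans n2; rewrite ltrDl.
- move=> x; rewrite -nuE; have := nuz (t, x); have := zM (t, x).
  have := ler_norm M; rewrite /M' !ler_norml; lra.
- move=> x y xy; rewrite -!nuE; have := nuz (t, x); have := nuz (t, y).
  have := zosc _ _ _ xy; rewrite !ler_norml; lra.
Unshelve. all: by end_near. Qed.

(** The approximation - nu_n(t, tau) converges to - G(t, tau), and symmetry turns
    this into convergence to G(t, tau). *)
Lemma quantile_clt_normalized :
  clt_linf P
    (fun n (s : E * I) w => quantile_process X Xs n s.1 (val s.2) w * f s.1 (tau s.1 (val s.2)))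
    (fun (s : E * I) w => G (s.1, tau s.1 (val s.2)) w).
Proof.
have cG := X_clt.2.
have c1 : forall s : E * I, `|1 : R| <= 1 by move=> _; rewrite normr1.
have cN1 : forall s : E * I, `|-1 : R| <= 1 by move=> _; rewrite normrN1.
pose phi (s : E * I) := (s.1, tau s.1 (val s.2)).
have [gL rL _] : clt_linf P (fun n s w => 1 * emp_process X Xs n (phi s) w)
    (fun s w => 1 * G (phi s) w) by exact: clt_reweight c1 cG.
have LE : (fun s w => 1 * G (phi s) w) = (fun s w => G (phi s) w).
  by apply/funext => s; apply/funext => w; rewrite mul1r.
rewrite LE in gL rL.
have [_ _ cN] : clt_linf P (fun n s w => -1 * emp_process X Xs n (phi s) w)
    (fun s w => -1 * G (phi s) w) by exact: clt_reweight cN1 cG.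
apply: (@clt_slutsky _ _ _ _ _ (fun n s w => -1 * emp_process X Xs n (phi s) w)); last first.
  by move=> r c r0 c0; exact: quantile_process_linearization.
split => // h bh ch.
rewrite -(gaussian_law_opp gL rL bh ch).
have := cN h bh ch.
rewrite (_ : (fun w => h (fun s => -1 * G (phi s) w)) = (fun w => h (fun s => - G (phi s) w)))//.
by apply/funext => w; congr h; apply/funext => s; rewrite mulN1r.
Qed.

Lemma quantile_clt :
  clt_linf P
    (fun n (s : E * I) w => quantile_process X Xs n s.1 (val s.2) w)
    (fun (s : E * I) w => G (s.1, tau s.1 (val s.2)) w / f s.1 (tau s.1 (val s.2))).
Proof.
pose m (s : E * I) := (f s.1 (tau s.1 (val s.2)))^-1.
have fk (s : E * I) : kappa <= f s.1 (tau s.1 (val s.2)).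
  by apply: (f_low (set_type_itvP s.2)); rewrite subrr normr0 ltW.
have f0 (s : E * I) : 0 < f s.1 (tau s.1 (val s.2)) by exact: lt_le_trans (fk s).
have mb s : `|m s| <= kappa^-1.
  by rewrite gtr0_norm ?invr_gt0// lef_pV2 ?posrE.
have := clt_reweight id mb quantile_clt_normalized.
rewrite (_ : (fun n s w => _) = (fun n (s : E * I) w => quantile_process X Xs n s.1 (val s.2) w)).
  rewrite (_ : (fun s w => m s * _) = (fun (s : E * I) w => G (s.1, tau s.1 (val s.2)) w / f s.1 (tau s.1 (val s.2))))//.
  by apply/funext => s; apply/funext => w; rewrite mulrC.
apply/funext => n; apply/funext => s; apply/funext => w.
by rewrite mulrC mulfK// gt_eqF.
Qed.

End quantile_clt.

Theorem corollary1 (R : realType)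
  (d0 d : measure_display) (T0 : measurableType d0) (T : measurableType d)
  (P0 : probability T0 R) (P : probability T R)
  (E : choiceType) (D : set (E -> R))
  (X : E -> {RV P0 >-> R}) (Xs : nat -> E -> {RV P >-> R})
  (G : E * R -> T -> R) (f : E -> R -> R)
  (X_in_D : {ae P0, forall w, D (fun t => X t w)})
  (Xs_in_D : forall i, {ae P, forall w, D (fun t => Xs i t w)})
  (Xs_iid : iid_copies X Xs)
  (X_clt : empirical_clt X Xs G)
  (F_incr : forall t x y, x < y -> dist_fun X t x < dist_fun X t y)
  (F_density : forall t, has_density (dist_fun X t) (f t))
  (f_unif : sup_modulus f delta @[delta --> 0^'+] --> 0%E)
  (f_low : forall a b : R, 0 < a -> a <= b -> b < 1 ->
     exists2 theta : R, 0 < theta &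
       (0 < ereal_inf [set r | exists t alpha x,
              [/\ (a <= alpha <= b)%R,
                  (`|x - quantile (dist_fun X t) alpha| <= theta)%R &
                  r = (f t x)%:E]])%E)
  (a b : R) (ha : 0 < a) (hab : a <= b) (hb : b < 1) :
  clt_linf P
    (fun n (s : E * set_type `[a, b]%classic) w =>
       quantile_process X Xs n s.1 (val s.2) w *
       f s.1 (quantile (dist_fun X s.1) (val s.2)))
    (fun (s : E * set_type `[a, b]%classic) w =>
       G (s.1, quantile (dist_fun X s.1) (val s.2)) w)
  /\
  clt_linf P
    (fun n (s : E * set_type `[a, b]%classic) w =>
       quantile_process X Xs n s.1 (val s.2) w)
    (fun (s : E * set_type `[a, b]%classic) w =>
       G (s.1, quantile (dist_fun X s.1) (val s.2)) w /
       f s.1 (quantile (dist_fun X s.1) (val s.2))).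
Proof.
have [theta theta0 inf0] := f_low _ _ ha hab hb.
set J := ereal_inf _ in inf0.
have [kappa kappa0 kJ] : exists2 kappa : R, 0 < kappa & (kappa%:E <= J)%E.
  case: J inf0 => [k|_|//]; first by rewrite lte_fin => k0; exists k.
  (* J is +oo only when E is empty *)
  by exists 1; rewrite ?leey.
have fk t alpha x : a <= alpha <= b -> `|x - quantile (dist_fun X t) alpha| <= theta ->
    kappa <= f t x.
  move=> aab xt; rewrite -lee_fin; apply: le_trans kJ _.
  by apply: ereal_inf_lbound; exists t, alpha, x.
split.
  exact: quantile_clt_normalized X_clt F_density f_unif ha hb kappa0 theta0 fk.
exact: quantile_clt X_clt F_density f_unif ha hb kappa0 theta0 fk.
Qed.
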